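(* Let $(g^{[\infty]}_t:t\ge0)$ be the hydrodynamic limit of the radial multiple SLE driven by circular Dyson Brownian motions started from the single source $\delta_1$, and let $\mathbb{D}^{[\infty]}_t$ be the domain of $g^{[\infty]}_t$. Let $W_0$ be the principal branch of the Lambert function and put $\Lambda_t(z)=4t\,\dfrac{z}{(1-z)^2}$. Then at each $t\ge 0$, for $z\in\mathbb{D}^{[\infty]}_t$, $$g^{[\infty]}_t(z)=\left[1+\frac{2t}{W_0(\Lambda_t(z)e^{-t})}\left(1-\sqrt{1+W_0(\Lambda_t(z)e^{-t})/t}\right)\right]e^{2t\sqrt{1+W_0(\Lambda_t(z)e^{-t})/t}}.$$
   Context: $\mathbb{D}$ is the open unit disk and $\mathbb{S}$ the unit circle in $\mathbb{C}$. Finite-$N$ objects: fix $\beta>0$. The $N$-particle circular $\beta$-Dyson Brownian motions are $X^{(i)}_t=e^{\sqrt{-1}\,\Theta^{(i)}_t}$, $i=1,\dots,N$, with $d\Theta^{(i)}_t=\sqrt{8/\beta}\,dB^{(i)}_t+2\sum_{j\ne i}\cot\big((\Theta^{(i)}_t-\Theta^{(j)}_t)/2\big)dt$, the $B^{(i)}$ being independent standard Brownian motions. The radial multiple SLE $(g^{[N]}_t)$ driven by them solves $\frac{d}{dt}g_t(z)=-\sum_{i=1}^N g_t(z)\frac{g_t(z)+X^{(i)}_t}{g_t(z)-X^{(i)}_t}$, $g_0(z)=z\in\mathbb{D}$. Assume $\frac1N\sum_{i=1}^N\delta_{X^{(i)}_0}\to\delta_1$ weakly as $N\to\infty$. Hydrodynamic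 limit: it is known that $\frac1N\sum_i\delta_{X^{(i)}_{t/N}}$ converges weakly almost surely to a deterministic measure-valued process $(\mu_t)_{t\ge0}$ on $\mathbb{S}$ with $\mu_0=\delta_1$, characterized by the fact that $M_t(z)=\int_{\mathbb{S}}\frac{x+z}{x-z}\mu_t(dx)$ solves $\partial_tM_t(z)+2zM_t(z)\partial_zM_t(z)=0$ with $M_0(z)=\frac{1+z}{1-z}$; and that $g^{[N]}_{t/N}$ converges locally uniformly in distribution to $g^{[\infty]}_t$, the solution of the measure-driven radial Loewner equation $$\frac{d}{dt}g^{[\infty]}_t(z)=g^{[\infty]}_t(z)\,M_t\big(g^{[\infty]}_t(z)\big),\qquad g^{[\infty]}_0(z)=z\in\mathbb{D}.$$ $\mathbb{D}^{[\infty]}_t$ is the set of $z\in\mathbb{D}$ for which the solution exists until time $t$, and $g^{[\infty]}_t:\mathbb{D}^{[\infty]}_t\to\mathbb{D}$ is a conformal bijection. Lambert function: $W_0$ is the inverse of $w\mapsto we^w$ with $W_0(0)=0$, given by $W_0(z)=\sum_{n\ge1}\frac{(-n)^{n-1}}{n!}z^n$ for $|z|<e^{-1}$ and analytically continued to $\mathbb{C}\setminus(-\infty,-e^{-1}]$. The square root is the principal branch. At $z=0$ or $t=0$ the right-hand side is understood as the limit. *)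

(* Defs.v *)
From HB Require Import structures.
From mathcomp Require Import all_boot all_order all_algebra.
From mathcomp Require Import all_classical all_reals all_analysis.
From mathcomp Require Import complex.

Set Implicit Arguments.
Unset Strict Implicit.
Unset Printing Implicit Defensive.

Import Order.TTheory GRing.Theory Num.Theory.
Import numFieldNormedType.Exports.

Local Open Scope classical_set_scope.
Local Open Scope complex_scope.
Local Open Scope ring_scope.

(* Norm and topology of R[i] as a normed space over itself. *)
HB.instance Definition _ (R : realType) := NormedModule.copy R[i] (R[i]^o).

(* [complex.Re] and [complex.Im] have values in [R]; [x%:C] embeds [R] into
   [R[i]]; the order of [R[i]] compares real numbers, so [`|z| < 1] is meant
   inside [R[i]]. *)

Definition disk (R : realType) : set R[i] := [set z | `|z| < 1].

Definition circle (R : realType) : set R[i] := [set z | `|z| = 1].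

Definition cexp (R : realType) (z : R[i]) : R[i] :=
  (expR (complex.Re z))%:C
  * (cos (complex.Im z) +i* sin (complex.Im z)).

(* The complex plane with its Borel sigma-algebra. *)
Notation borelC R := (g_sigma_algebraType (@open R[i])).

(* Derivative along the set [A] of a complex function of a real variable:
   two-sided at the interior points of an interval [A], one-sided at its
   endpoints. *)
Definition has_derivative_within (R : realType) (A : set R) (f : R -> R[i])
    (s : R) (l : R[i]) : Prop :=
  (f x - f s) / (x - s)%:C @[x --> within A s^'] --> l.

(* M_t(z) = int_S (x + z) / (x - z) mu_t(dx), through the real and imaginary
   parts of the integrand. *)
Definition herglotz (R : realType) (mu : R -> probability (borelC R) R)
    (t : R) (z : R[i]) : R[i] :=
  (\int[mu t]_(x in @circle R)
      complex.Re (((x : R[i]) + z) / ((x : R[i]) - z)))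
  +i* (\int[mu t]_(x in @circle R)
      complex.Im (((x : R[i]) + z) / ((x : R[i]) - z))).

(* [derive1 (M t)] is the complex derivative of M_t in z, and the time
   derivative at t = 0 is the right one. *)
Record burgers_solution (R : realType) (M : R -> R[i] -> R[i]) : Prop := {
  burgers_init : forall z : R[i], disk z -> M 0 z = (1 + z) / (1 - z);
  burgers_derivable : forall (t : R) (z : R[i]), 0 <= t -> disk z ->
    derivable (M t) z 1;
  burgers_pde : forall (t : R) (z : R[i]), 0 <= t -> disk z ->
    has_derivative_within `[0, +oo[ (fun s => M s z) t
      (- (2 * z * M t z * derive1 (M t) z))
}.

(* The limit of the empirical measures at time t / N of the circular Dyson
   Brownian motions with single source 1. It is taken in the form that
   characterizes it: a process of probability measures on the circle issued from
   delta_1 whose Herglotz transform solves the complex Burgers equation. *)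
Record hydrodynamic_limit (R : realType) (mu : R -> probability (borelC R) R) :
    Prop := {
  hydro_circle : forall t : R, 0 <= t -> mu t (@circle R) = 1%E;
  hydro_init : forall A : set (borelC R), measurable A ->
    mu 0 A = @dirac _ (borelC R) 1 R A;
  hydro_burgers : burgers_solution (herglotz mu)
}.

(* [gam] solves the radial Loewner equation with vector field [w * M_s(w)],
   started at [z] and staying in the disk, on the time interval [0, t]. *)
Definition loewner_trajectory (R : realType) (M : R -> R[i] -> R[i])
    (t : R) (z : R[i]) (gam : R -> R[i]) : Prop :=
  gam 0 = z /\
  forall s : R, 0 <= s <= t ->
    disk (gam s) /\
    has_derivative_within `[0, t] gam s (gam s * M s (gam s)).

Definition loewner_domain (R : realType) (M : R -> R[i] -> R[i]) (t : R) :
    set R[i] :=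
  [set z | disk z /\ exists gam : R -> R[i], loewner_trajectory M t z gam].

Definition loewner_flow (R : realType) (M g : R -> R[i] -> R[i]) : Prop :=
  forall (t : R) (z : R[i]), 0 <= t -> loewner_domain M t z ->
    loewner_trajectory M t z (fun s => g s z).

(* The plane cut along ]-oo, - e^-1]. *)
Definition lambert_plane (R : realType) : set R[i] :=
  [set z | ~ (complex.Im z = 0 /\ complex.Re z <= - expR (-1))].

(* The series is sum_(n >= 1) (-n)^(n-1) / n! z^n, reindexed from 0. The clauses
   determine [W0] on [lambert_plane]; its values on the cut are irrelevant. *)
Record principal_lambert (R : realType) (W0 : R[i] -> R[i]) : Prop := {
  lambert0 : W0 0 = 0;
  lambert_inverse : forall z : R[i], @lambert_plane R z ->
    W0 z * cexp (W0 z) = z;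
  lambert_series : forall z : R[i], `|z| < (expR (-1))%:C ->
    series (fun n : nat =>
      (- n.+1%:R) ^+ n / (n.+1)`!%:R * z ^+ n.+1 : R[i]) @ \oo --> W0 z;
  lambert_holomorphic : forall z : R[i], @lambert_plane R z ->
    derivable W0 z 1
}.

Definition Lambda (R : realType) (t : R) (z : R[i]) : R[i] :=
  4 * t%:C * (z / (1 - z) ^+ 2).

(* [sqrtc] is the principal square root (nonnegative real part, cut along the
   negative reals), unlike [sqrtC]. For t = 0 or z = 0 this formula has zero
   denominators, and its value is not meaningful. *)
Definition lambert_formula (R : realType) (W0 : R[i] -> R[i])
    (t : R) (z : R[i]) : R[i] :=
  let w := W0 (Lambda t z * (expR (- t))%:C) in
  let r := sqrtc (1 + w / t%:C) in
  (1 + 2 * t%:C / w * (1 - r)) * cexp (2 * t%:C * r).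

(* Main.v *)
Require Import Defs.
From HB Require Import structures.
From mathcomp Require Import all_boot all_order all_algebra.
From mathcomp Require Import all_classical all_reals all_analysis.
From mathcomp Require Import complex ring lra.
Import Order.TTheory GRing.Theory Num.Theory.
Import numFieldNormedType.Exports.
Import Normc.
Local Open Scope classical_set_scope.
Local Open Scope complex_scope.
Local Open Scope ring_scope.

Set Implicit Arguments.
Unset Strict Implicit.
Unset Printing Implicit Defensive.

(** The characteristics [s |-> u exp (2 s M_0(u))] of the Burgers equation start
    at a point [u] of the disk and move outwards, since [Re M_0 > 0]; hence
    [M_s] equals [M_0(u)] at the point reached at time [s], as long as it lies in
    the disk.  Write the Loewner trajectory as [g_s = u_s exp (2 s m_s)] with
    [m_s = M_0(u_s) = (1 + u_s) / (1 - u_s)].  The Loewner equation becomes an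
    ODE for [u] in which [s m^2 + log (u / (1 - u)^2)] is conserved.  With
    [w = s (m^2 - 1) = 4 s u / (1 - u)^2] this reads [w e^w = Lambda_s(z) e^(-s)].

    Conversely, define [w], [m] and [u] from [W0 (Lambda_s(z) e^(-s))].  This is
    possible for every [z] of the disk and every [s >= 0]: since
    [1 + 4 z / (1 - z)^2 = ((1 + z) / (1 - z))^2] avoids the negative reals and
    [s e^(-s) <= e^(-1)], the argument of [W0] stays off the cut, and so does
    the argument [1 + w / s] of the square root.  The resulting curve solves the
    Loewner equation while it stays in the disk, and Gronwall's inequality
    identifies it with [g]. *)

(** * Limits in the complex plane *)

(** Radii are real and the modulus is the real-valued [normc], so that estimates stay in [R] instead
    of the partially ordered [R[i]]; [ccvgP] identifies this with topological convergence. *)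
Definition ccvg (R : realType) T (F : set_system T) (f : T -> R[i]) (a : R[i]) :=
  forall e : R, 0 < e -> F (fun x => normc (f x - a) < e).

Section ComplexLimitRules.
Context {R : realType} {T : Type} {F : set_system T} {FF : Filter F}.
Implicit Types (f g : T -> R[i]) (a b : R[i]).

Lemma gt0_complexP (e : R[i]) : 0 < e -> exists2 e' : R, 0 < e' & e = e'%:C.
Proof.
move=> e0; exists (complex.Re e); first by move: e0; rewrite ltcE => /andP[_].
by rewrite RRe_real// gtr0_real.
Qed.

Lemma ccvgP f a : f @ F --> a <-> ccvg F f a.
Proof.
split=> [fa e e0|H].
  have e0' : 0 < e%:C by rewrite ltcR.
  have := (@cvgrPdistC_lt R[i] R[i] T F FF f a).1 fa _ e0'.
  by apply: filterS => x; rewrite -ltcR.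
have [_ K] := (@cvgrPdist_lt R[i] R[i] T F FF f a); apply: K => e /gt0_complexP[e' e0 ->].
have := H _ e0; apply: filterS => x; rewrite -ltcR distrC; exact.
Qed.

Lemma ccvgM f g a b : ccvg F f a -> ccvg F g b -> ccvg F (fun x => f x * g x) (a * b).
Proof.
move=> /ccvgP fa /ccvgP gb; apply/ccvgP.
have H := @cvgM R[i] T F FF f g a b fa gb.
exact: H.
Qed.

Lemma ccvgD f g a b : ccvg F f a -> ccvg F g b -> ccvg F (fun x => f x + g x) (a + b).
Proof.
move=> /ccvgP fa /ccvgP gb; apply/ccvgP.
have H := @cvgD R[i] R[i] T F FF f g a b fa gb.
exact: H.
Qed.

Lemma ccvgN f a : ccvg F f a -> ccvg F (fun x => - f x) (- a).
Proof.
move=> /ccvgP fa; apply/ccvgP; have H := @cvgN R[i] R[i] T F FF f a fa.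
exact: H.
Qed.

Lemma ccvgB f g a b : ccvg F f a -> ccvg F g b -> ccvg F (fun x => f x - g x) (a - b).
Proof. by move=> fa gb; apply: ccvgD => //; exact: ccvgN. Qed.

Lemma ccvgV f a : a != 0 -> ccvg F f a -> ccvg F (fun x => (f x)^-1) a^-1.
Proof.
move=> a0 /ccvgP fa; apply/ccvgP; have H := @cvgV R[i] T F FF f a a0 fa.
exact: H.
Qed.

Lemma ccvg_cst a : ccvg F (fun=> a) a.
Proof.
by move=> e e0; apply: filterE => x; rewrite subrr normc0.
Qed.

Lemma ccvg_unique f a b : ProperFilter F -> ccvg F f a -> ccvg F f b -> a = b.
Proof.
move=> PF /ccvgP fa /ccvgP fb.
have H := @cvg_unique R[i] (@norm_hausdorff R[i] R[i]) (f @ F) _ a b fa fb.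
exact: H.
Qed.

Lemma ccvg_eq f g a : F (fun x => f x = g x) -> ccvg F f a -> ccvg F g a.
Proof.
by move=> fg fa e /fa; apply: filterS2 fg => x ->.
Qed.

Lemma ccvg_comp f a (h : R[i] -> R[i]) b : ccvg F f a -> ccvg (nbhs a) h b ->
  ccvg F (fun x => h (f x)) b.
Proof. by move=> /ccvgP fa ha e /ha; exact: fa. Qed.

End ComplexLimitRules.

Section Modulus.
Variable R : realType.
Implicit Types (z w : R[i]).

Lemma ger0_normc z : 0 <= normc z.
Proof. by case: z => a b; exact: sqrtr_ge0. Qed.

Lemma ler_normcD z w : normc (z + w) <= normc z + normc w.
Proof. by rewrite -lecR rmorphD; exact: (@ler_normD _ R[i]). Qed.

Lemma normc_opp z : normc (- z) = normc z.
Proof. by apply: complexI; exact: (@normrN R[i] R[i]). Qed.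

Lemma normc_distC z w : normc (z - w) = normc (w - z).
Proof. by rewrite -normc_opp opprB. Qed.

Lemma ler_normcB z w : normc (z - w) <= normc z + normc w.
Proof. by rewrite -(normc_opp w) ler_normcD. Qed.

Lemma lerB_normc z w : normc z - normc w <= normc (z - w).
Proof. by rewrite lerBlDr -{1}(subrK w z) ler_normcD. Qed.

Lemma normc_real (x : R) : normc x%:C = `|x|.
Proof. by rewrite /= expr0n addr0 sqrtr_sqr. Qed.

Lemma normc_sqr z : normc z ^+ 2 = complex.Re z ^+ 2 + complex.Im z ^+ 2.
Proof. by case: z => a b /=; rewrite sqr_sqrtr// addr_ge0// sqr_ge0. Qed.

Lemma Re_le_normc z : `|complex.Re z| <= normc z.
Proof.
rewrite -(ler_pXn2r (n := 2)) ?nnegrE ?ger0_normc//.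
rewrite normc_sqr (real_normK (num_real (complex.Re z))).
by rewrite lerDl sqr_ge0.
Qed.

Lemma Im_le_normc z : `|complex.Im z| <= normc z.
Proof.
rewrite -(ler_pXn2r (n := 2)) ?nnegrE ?ger0_normc//.
rewrite normc_sqr (real_normK (num_real (complex.Im z))).
by rewrite lerDr sqr_ge0.
Qed.

Lemma normc_le_ReIm z : normc z <= `|complex.Re z| + `|complex.Im z|.
Proof.
rewrite -(ler_pXn2r (n := 2)) ?nnegrE ?ger0_normc ?addr_ge0//.
rewrite normc_sqr sqrrD (real_normK (num_real (complex.Re z))).
by rewrite (real_normK (num_real (complex.Im z))) addrAC lerDl mulrn_wge0//.
Qed.

Lemma normc_eq0 z : (normc z == 0) = (z == 0).
Proof.
by apply/eqP/eqP => [/eq0_normc//|->]; rewrite normc0.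
Qed.

Lemma diskE z : disk z <-> normc z < 1.
Proof. by rewrite /disk /= -ltcR. Qed.

End Modulus.

Section ComplexLimits.
Context {R : realType} {T : Type} {F : set_system T} {FF : Filter F}.
Implicit Types (f : T -> R[i]) (a : R[i]).

Lemma ccvg_norm0 f a (h : T -> R) : (\forall x \near F, normc (f x - a) <= h x) ->
  h @ F --> (0 : R) -> ccvg F f a.
Proof.
move=> H h0 e e0.
have := (@cvgrPdistC_lt R R T F FF h 0).1 h0 e e0.
move: H; apply: filterS2 => x h1 h2; apply: (le_lt_trans h1).
by move: h2; rewrite subr0; apply: le_lt_trans; rewrite ler_norm.
Qed.

Lemma cvg_normcB f a : ccvg F f a -> (fun x => normc (f x - a)) @ F --> (0 : R).
Proof.
move=> fa; have [_ K] := @cvgrPdistC_lt R R T F FF (fun x => normc (f x - a)) 0.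
apply: K => e /fa; apply: filterS => x; rewrite subr0 ger0_norm// ger0_normc//.
Qed.

Lemma cvg_Re f a : ccvg F f a -> (fun x => complex.Re (f x)) @ F --> complex.Re a.
Proof.
move=> fa; have [_ K] := @cvgrPdistC_lt R R T F FF (fun x => complex.Re (f x)) (complex.Re a).
apply: K => e /fa; apply: filterS => x; apply: le_lt_trans.
by rewrite -raddfB Re_le_normc.
Qed.

Lemma cvg_Im f a : ccvg F f a -> (fun x => complex.Im (f x)) @ F --> complex.Im a.
Proof.
move=> fa; have [_ K] := @cvgrPdistC_lt R R T F FF (fun x => complex.Im (f x)) (complex.Im a).
apply: K => e /fa; apply: filterS => x; apply: le_lt_trans.
by rewrite -raddfB Im_le_normc.
Qed.

Lemma cvg_normc f a : ccvg F f a -> (fun x => normc (f x)) @ F --> normc a.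
Proof.
move=> fa; have [_ K] := @cvgrPdistC_lt R R T F FF (fun x => normc (f x)) (normc a).
apply: K => e /fa; apply: filterS => x; apply: le_lt_trans.
by rewrite ler_norml lerNl opprB normc_distC lerB_normc normc_distC lerB_normc.
Qed.

Lemma ccvg_real (f : T -> R) (a : R) : f @ F --> a -> ccvg F (fun x => (f x)%:C) a%:C.
Proof.
move=> fa e e0.
have := (@cvgrPdistC_lt R R T F FF f a).1 fa e e0.
by apply: filterS => x; rewrite -rmorphB normc_real.
Qed.

Lemma ccvg_complex (f g : T -> R) (a b : R) : f @ F --> a -> g @ F --> b ->
  ccvg F (fun x => f x +i* g x) (a +i* b).
Proof.
move=> fa gb; apply: (@ccvg_norm0 _ _ (fun x => `|f x - a| + `|g x - b|)).
  apply: nearW => x; have := @normc_le_ReIm R ((f x +i* g x) - (a +i* b)).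
  by rewrite !raddfB /=; exact.
rewrite -[0]addr0 -[X in X + _](normr0 R) -[X in _ + X](normr0 R).
apply: cvgD; apply: cvg_norm; apply/subr_cvg0 => //.
Qed.

End ComplexLimits.

(** * The complex exponential *)

Section Cexp.
Variable R : realType.
Implicit Types (z w : R[i]).

Lemma cexpD z w : cexp (z + w) = cexp z * cexp w.
Proof.
case: z w => [a b] [c d]; rewrite /cexp /= expRD cosD sinD.
by apply/eqP; rewrite eq_complex /=; apply/andP; split; apply/eqP; ring.
Qed.

Lemma cexp_real (x : R) : cexp x%:C = (expR x)%:C.
Proof. by rewrite /cexp /= cos0 sin0 mulr1. Qed.

Lemma cexp0 : cexp 0 = 1 :> R[i].
Proof. by rewrite (cexp_real 0) expR0. Qed.

Lemma cexp_neq0 z : cexp z != 0.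
Proof.
apply/eqP => z0; have := cexpD z (- z); rewrite subrr cexp0 z0 mul0r.
by apply/eqP; rewrite oner_neq0.
Qed.

Lemma normc_cexp z : normc (cexp z) = expR (complex.Re z).
Proof.
rewrite /cexp normcM normc_real ger0_norm ?expR_ge0//=.
by rewrite cos2Dsin2 sqrtr1 mulr1.
Qed.

Lemma ccvg_cexp T (F : set_system T) {FF : Filter F} (f : T -> R[i]) a :
  ccvg F f a -> ccvg F (fun x => cexp (f x)) (cexp a).
Proof.
move=> fa.
have ra : (fun x => complex.Re (f x)) @ F --> complex.Re a by exact: cvg_Re.
have ia : (fun x => complex.Im (f x)) @ F --> complex.Im a by exact: cvg_Im.
apply: ccvgM; first apply: ccvg_real.
  exact: (cvg_comp _ _ ra (@continuous_expR R _)).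
apply: ccvg_complex.
  exact: (cvg_comp _ _ ia (@continuous_cos R _)).
exact: (cvg_comp _ _ ia (@continuous_sin R _)).
Qed.

(** The expansion avoids division so as to cover [a = 0] as well: it is applied to the two parts of
    a nonzero complex increment, one of which may vanish. *)
Lemma is_derive0_littleo (f : R -> R) (l : R) : is_derive (0 : R) 1 f l ->
  forall e, 0 < e ->
  \forall a \near (0 : R), `|f a - f 0 - l * a| <= e * `|a|.
Proof.
move=> [df dfl] e e0.
have : h^-1 *: (f (h + 0) - f 0) @[h --> 0^'] --> l.
  rewrite -dfl; have := df; rewrite /derivable /derive.
  under eq_fun do rewrite [_%:A]mulr1.
  exact.
move=> /cvgrPdistC_le /(_ e e0); rewrite near_withinE.
apply: filterS => a ha; have [->|a0] := eqVneq a 0.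
  by rewrite subrr mulr0 subr0 normr0 mulr0.
have -> : f a - f 0 - l * a = (a^-1 *: (f (a + 0) - f 0) - l) * a.
  by rewrite addr0 mulrBl [_ *: _]mulrC divfK.
by rewrite normrM ler_wpM2r//; exact: ha.
Qed.

(** With [h = a +i* b], each part of [cexp h - 1 - h] is a sum of three terms, all small compared
    with [normc h] by the real expansions of [expR], [sin] and [cos] at 0. *)
Lemma ccvg_cexpB1 : ccvg (0 : R[i])^' (fun h : R[i] => (cexp h - 1) / h) 1.
Proof.
move=> e e0.
(* Six error terms arise, each at most [d * normc h]; the factor 7 makes the final inequality
   strict. *)
pose d := Num.min 1 (e / 7).
have d0 : 0 < d by rewrite lt_min ltr01 divr_gt0.
have d1 : d <= 1 by rewrite ge_min lexx.
have de : 7 * d <= e.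
  by rewrite mulrC -ler_pdivlMr// ge_min lexx orbT.
have E1 := is_derive0_littleo (is_derive_expR (0:R)) d0.
have E2 := is_derive0_littleo (is_derive_sin (0:R)) d0.
have E3 := is_derive0_littleo (is_derive_cos (0:R)) d0.
have E4 : \forall a \near (0 : R), `|expR a - 1| <= d.
  have : expR @ (0 : R) --> (1 : R) by rewrite -(expR0 R); exact: continuous_expR.
  by move=> /cvgrPdistC_le; exact.
have fF : Filter (nbhs (0 : R[i])^') by exact: _.
have cid : ccvg (0 : R[i])^' id 0 by apply/ccvgP; exact: cvg_within.
have cRe : (@complex.Re R) @ (0 : R[i])^' --> (0 : R) by exact: (cvg_Re cid).
have cIm : (@complex.Im R) @ (0 : R[i])^' --> (0 : R) by exact: (cvg_Im cid).
have G1 : (0 : R[i])^' (fun h =>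
  `|expR (complex.Re h) - expR 0 - expR 0 * complex.Re h| <= d * `|complex.Re h|) := cRe _ E1.
have G2 : (0 : R[i])^' (fun h =>
  `|sin (complex.Im h) - sin 0 - cos 0 * complex.Im h| <= d * `|complex.Im h|) := cIm _ E2.
have G3 : (0 : R[i])^' (fun h =>
  `|cos (complex.Im h) - cos 0 - - sin 0 * complex.Im h| <= d * `|complex.Im h|) := cIm _ E3.
have G4 : (0 : R[i])^' (fun h => `|expR (complex.Re h) - 1| <= d) := cRe _ E4.
have G5 : (0 : R[i])^' (fun h => h != 0) by exact: nbhs_dnbhs_neq.
apply: (@filterS _ _ fF _ _ _
  (filterI (filterI G1 G2) (filterI (filterI G3 G4) G5))) => h /= [[]].
rewrite expR0 sin0 cos0 oppr0 mul0r !mul1r !subr0 => h1 h2 [[h3 h4] h5].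
have n0 : 0 < normc h.
  by rewrite lt_neqAle ger0_normc andbT eq_sym normc_eq0.
have ah := Re_le_normc h; have bh := Im_le_normc h.
have -> : (cexp h - 1) / h - 1 = (cexp h - 1 - h) / h by rewrite [RHS]mulrBl divff.
rewrite normcM normcV ltr_pdivrMr//.
set n := normc h in n0 ah bh *.
apply: (le_lt_trans (normc_le_ReIm _)); rewrite /cexp !raddfB /= !mul0r subr0 addr0.
set a := complex.Re h in h1 h4 ah *; set b := complex.Im h in h2 h3 bh *.
rewrite addr0 in h2.
set A := expR a in h1 h4 *.
have -> : A * cos b - 1 - a = (A - 1 - a) + (A - 1) * (cos b - 1) + (cos b - 1) by ring.
have -> : A * sin b - 0 - b = (A - 1) * (sin b - b) + (A - 1) * b + (sin b - b) by ring.
have dn0 : 0 < d * n by rewrite mulr_gt0.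
have k1 : `|A - 1 - a| <= d * n by apply: (le_trans h1); rewrite ler_pM2l.
have k3 : `|cos b - 1| <= d * n by apply: (le_trans h3); rewrite ler_pM2l.
have k2 : `|sin b - b| <= d * n by apply: (le_trans h2); rewrite ler_pM2l.
have k4 : `|(A - 1) * (cos b - 1)| <= d * n.
  rewrite normrM -[leRHS]mul1r; apply: ler_pM => //; exact: le_trans h4 d1.
have k5 : `|(A - 1) * (sin b - b)| <= d * n.
  rewrite normrM -[leRHS]mul1r; apply: ler_pM => //; exact: le_trans h4 d1.
have k6 : `|(A - 1) * b| <= d * n by rewrite normrM; apply: ler_pM.
have k7 := ler_wpM2r (ltW n0) de.
have t1 := ler_normD (A - 1 - a + (A - 1) * (cos b - 1)) (cos b - 1).
have t2 := ler_normD (A - 1 - a) ((A - 1) * (cos b - 1)).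
have t3 := ler_normD ((A - 1) * (sin b - b) + (A - 1) * b) (sin b - b).
have t4 := ler_normD ((A - 1) * (sin b - b)) ((A - 1) * b).
by lra.
Qed.

End Cexp.

(** * Derivatives of complex functions of a real variable *)

Definition cderiv (R : realType) (A : set R) (f : R -> R[i]) (s : R) (l : R[i]) :=
  ccvg (within A s^') (fun x => (f x - f s) / (x - s)%:C) l.

Section Derivatives.
Variables (R : realType) (A : set R) (s : R).
Implicit Types (f g : R -> R[i]).

Let F := within A s^'.
Let FF : Filter F := _.

Lemma cderivP f l : has_derivative_within A f s l <-> cderiv A f s l.
Proof. exact: ccvgP. Qed.

Lemma ccvg_id : ccvg F (fun x => x%:C) s%:C.
Proof.
by apply: ccvg_real; apply: cvg_within_filter; apply: cvg_within.
Qed.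

Lemma near_neq : F (fun x => x != s).
Proof.
have ne : \forall x \near s^', x != s by exact: nbhs_dnbhs_neq.
by rewrite /F /within; move: ne; apply: filterS => x xs _.
Qed.

Lemma cderiv_cvg f l : cderiv A f s l -> ccvg F f (f s).
Proof.
move=> fl.
have c : ccvg F (fun x => (x - s)%:C) 0.
  rewrite -(subrr s%:C); apply: ccvg_eq (ccvgB ccvg_id (ccvg_cst s%:C)).
  by apply: filterE => x; rewrite rmorphB.
have -> : f s = l * 0 + f s by rewrite mulr0 add0r.
apply: ccvg_eq (ccvgD (ccvgM fl c) (ccvg_cst (f s))); move: near_neq; apply: filterS => x xs.
rewrite divfK ?subrK//.
by rewrite (inj_eq (@complexI _)) subr_eq0.
Qed.

Lemma cderiv_eq f g l k : cderiv A f s l -> (forall x, A x -> f x = g x) -> A s -> l = k ->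
  cderiv A g s k.
Proof.
move=> fl fg As <-; apply: ccvg_eq fl.
by apply: (@filterE _ s^') => x Ax; rewrite !fg.
Qed.

Lemma cderiv_cst (c : R[i]) : cderiv A (fun=> c) s 0.
Proof.
have c0 := @ccvg_cst R R F FF 0; apply: ccvg_eq c0.
by apply: filterE => x; rewrite subrr mul0r.
Qed.

Lemma cderiv_id : cderiv A (fun x => x%:C) s 1.
Proof.
have c0 := @ccvg_cst R R F FF 1; apply: ccvg_eq c0.
move: near_neq; apply: filterS => x xs.
by rewrite rmorphB divff// subr_eq0 (inj_eq (@complexI _)).
Qed.

Lemma cderivD f g l k : cderiv A f s l -> cderiv A g s k -> cderiv A (fun x => f x + g x) s (l + k).
Proof.
move=> fl gk; apply: ccvg_eq (ccvgD fl gk).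
by apply: filterE => x; rewrite -mulrDl opprD addrACA.
Qed.

Lemma cderivN f l : cderiv A f s l -> cderiv A (fun x => - f x) s (- l).
Proof.
move=> fl; apply: ccvg_eq (ccvgN fl).
by apply: filterE => x; rewrite -opprD mulNr.
Qed.

Lemma cderivB f g l k : cderiv A f s l -> cderiv A g s k -> cderiv A (fun x => f x - g x) s (l - k).
Proof. by move=> fl gk; apply: cderivD => //; apply: cderivN. Qed.

Lemma cderivM f g l k : cderiv A f s l -> cderiv A g s k ->
  cderiv A (fun x => f x * g x) s (l * g s + f s * k).
Proof.
move=> fl gk; have gs := cderiv_cvg gk.
apply: ccvg_eq (ccvgD (ccvgM fl gs) (ccvgM (ccvg_cst (f s)) gk)).
by apply: filterE => x; ring.
Qed.

(* Caratheodory's form: [Psi] is the slope of the outer function. *)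
Lemma cderiv_comp f l (Phi Psi : R[i] -> R[i]) : cderiv A f s l ->
  F (fun x => Phi (f x) - Phi (f s) = Psi (f x) * (f x - f s)) ->
  ccvg F (fun x => Psi (f x)) (Psi (f s)) ->
  cderiv A (fun x => Phi (f x)) s (Psi (f s) * l).
Proof.
move=> fl H cP; apply: ccvg_eq (ccvgM cP fl).
by move: H; apply: filterS => x ->; rewrite mulrA.
Qed.

Lemma ccvg_neq0 f a : ccvg F f a -> a != 0 -> F (fun x => f x != 0).
Proof.
move=> fa a0.
have na : 0 < normc a by rewrite lt_neqAle ger0_normc eq_sym normc_eq0 a0.
have := fa _ na; apply: filterS => x hx.
by apply/eqP => fx0; move: hx; rewrite fx0 sub0r normc_opp ltxx.
Qed.

Lemma cderivV f l : cderiv A f s l -> f s != 0 -> cderiv A (fun x => (f x)^-1) s (- l / f s ^+ 2).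
Proof.
move=> fl f0; have fs := cderiv_cvg fl.
have -> : - l / f s ^+ 2 = - (f s * f s)^-1 * l by rewrite expr2 mulrC mulrN mulNr.
apply: (@cderiv_comp f l (fun y => y^-1) (fun y => - (y * f s)^-1)) => //; last first.
  by apply: ccvgN; apply: ccvgV; [rewrite mulf_neq0|apply: ccvgM => //; exact: ccvg_cst].
move: (ccvg_neq0 fs f0); apply: filterS => x fx0.
by field; rewrite f0 fx0.
Qed.

Lemma cderiv_cexp f l : cderiv A f s l -> cderiv A (fun x => cexp (f x)) s (cexp (f s) * l).
Proof.
move=> fl; have fs := cderiv_cvg fl.
(* The quotient is completed by its limit at 0; up to the factor [cexp (f s)] it is the slope of
   [cexp] at [f s]. *)
pose E h : R[i] := if h == 0 then 1 else (cexp h - 1) / h.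
have cE : ccvg (nbhs (0 : R[i])) E 1.
  have E0 : E 0 = 1 by rewrite /E eqxx.
  rewrite -E0; apply/ccvgP; apply/(@continuous_withinNx R[i] R[i]); apply/ccvgP; rewrite E0.
  apply: ccvg_eq (@ccvg_cexpB1 R).
  have : \forall x \near (0 : R[i])^', x != 0 by exact: nbhs_dnbhs_neq.
  by apply: filterS => x /negPf x0; rewrite /E x0.
have c0 : ccvg F (fun x => f x - f s) 0.
  by rewrite -(subrr (f s)); apply: ccvgB => //; exact: ccvg_cst.
have EE : E (f s - f s) = 1 by rewrite subrr /E eqxx.
have := @cderiv_comp f l (@cexp R) (fun y => cexp (f s) * E (y - f s)) fl.
rewrite EE mulr1; apply.
  apply: filterE => x; rewrite /E; case: eqP => [/subr0_eq ->|/eqP ne].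
    by rewrite !subrr mulr0.
  by rewrite -mulrA divfK// mulrBr mulr1 -cexpD [f s + _]addrC subrK.
rewrite -[X in ccvg _ _ X]mulr1; apply: ccvgM; first exact: ccvg_cst.
exact: ccvg_comp c0 cE.
Qed.

Lemma cderiv_unique f l k : ProperFilter F -> cderiv A f s l -> cderiv A f s k -> l = k.
Proof. by move=> PF; apply: ccvg_unique. Qed.

Lemma cderiv_subset (B : set R) f l : B `<=` A -> cderiv A f s l -> cderiv B f s l.
Proof.
move=> BA fl e e0; apply: (@filterS _ s^' _ _ _ _ (fl e e0)) => x h Bx.
exact: h (BA _ Bx).
Qed.

End Derivatives.

(** * The principal square root *)

Section SquareRoot.
Context {R : realType}.
Implicit Types z a : R[i].

Definition slit_plane z := ~ (complex.Im z = 0 /\ complex.Re z <= 0).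

Lemma Re_sqrtc_ge0 z : 0 <= complex.Re (sqrtc z).
Proof. by case: z => a b; exact: sqrtr_ge0. Qed.

(** A root with zero real part is purely imaginary, and its square lies on the cut. *)
Lemma Re_sqrtc_gt0 z : slit_plane z -> 0 < complex.Re (sqrtc z).
Proof.
move=> sz; rewrite lt_neqAle Re_sqrtc_ge0 andbT; apply/eqP => r0; apply: sz.
rewrite -(sqr_sqrtc z); move: r0; case: (sqrtc z) => x y /= <-.
by rewrite !mul0r mulr0 add0r sub0r oppr_le0 -expr2 sqr_ge0.
Qed.

Lemma slit_plane_sqr a : 0 < complex.Re a -> slit_plane (a ^+ 2).
Proof.
case: a => x y x0; rewrite /slit_plane expr2 /= => -[].
rewrite [y * x]mulrC -mulr2n => /eqP; rewrite mulrn_eq0/= mulf_eq0 gt_eqF//= => /eqP ->.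
by rewrite mulr0 subr0 leNgt mulr_gt0.
Qed.

Lemma Re_gt0_neq0 a : 0 < complex.Re a -> a != 0.
Proof. by move=> a0; apply/eqP => a00; move: a0; rewrite a00 ltxx. Qed.

Lemma sqrtc_sqr a : 0 < complex.Re a -> sqrtc (a ^+ 2) = a.
Proof.
move=> a0; have /eqP := sqr_sqrtc (a ^+ 2).
rewrite eqf_sqr => /orP[/eqP//|/eqP H].
by have := Re_sqrtc_ge0 (a ^+ 2); rewrite H raddfN oppr_ge0 leNgt a0.
Qed.

Lemma sqrtcB_mul z a : (sqrtc z - sqrtc a) * (sqrtc z + sqrtc a) = z - a.
Proof. by rewrite -subr_sqr !sqr_sqrtc. Qed.

Lemma Re_sqrtcD_gt0 z a : slit_plane a -> 0 < complex.Re (sqrtc z + sqrtc a).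
Proof. by move=> sa; rewrite raddfD ltr_wpDl ?Re_sqrtc_ge0 ?Re_sqrtc_gt0. Qed.

(** By [sqrtcB_mul], the increment of the root is that of its argument divided by a sum of roots,
    whose real part is at least that of [sqrtc a]. This bound holds even where [f] meets the cut. *)
Lemma ccvg_sqrtc T (F : set_system T) {FF : Filter F} (f : T -> R[i]) a :
  slit_plane a -> ccvg F f a -> ccvg F (fun x => sqrtc (f x)) (sqrtc a).
Proof.
move=> sa fa; have r0 := Re_sqrtc_gt0 sa.
apply: (@ccvg_norm0 R T F FF _ _ (fun x => normc (f x - a) / complex.Re (sqrtc a))).
  apply: filterE => x; rewrite ler_pdivlMr// -(sqrtcB_mul (f x) a) normcM ler_wpM2l ?ger0_normc//.
  apply: le_trans (Re_le_normc _); apply: le_trans (ler_norm _).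
  by rewrite raddfD lerDr Re_sqrtc_ge0.
have H : (fun x => normc (f x - a)) @ F --> (0 : R) by exact: cvg_normcB.
by rewrite -(mul0r (complex.Re (sqrtc a))^-1); apply: cvgM => //; exact: cvg_cst.
Qed.

Lemma cderiv_sqrtc (A : set R) (f : R -> R[i]) s l : cderiv A f s l -> slit_plane (f s) ->
  cderiv A (fun x => sqrtc (f x)) s (l / (2 * sqrtc (f s))).
Proof.
move=> fl sf; have fs := cderiv_cvg fl.
have n0 x : sqrtc x + sqrtc (f s) != 0 by apply/Re_gt0_neq0/Re_sqrtcD_gt0.
have -> : l / (2 * sqrtc (f s)) = (sqrtc (f s) + sqrtc (f s))^-1 * l.
  by rewrite mulrC -mulr2n mulr_natl.
apply: (@cderiv_comp R A s f l (@sqrtc R) (fun y => (sqrtc y + sqrtc (f s))^-1)) => //.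
  by apply: filterE => x; rewrite -(sqrtcB_mul (f x)) mulrC mulfK.
apply: ccvgV => //; apply: ccvgD; last exact: ccvg_cst.
exact: ccvg_sqrtc.
Qed.

End SquareRoot.

(** * Gronwall's inequality *)

Section Gronwall.
Context {R : realType}.

Lemma is_derive_cderiv (A : set R) (f : R -> R[i]) s l : nbhs s A -> cderiv A f s l ->
  is_derive s 1 (fun x => complex.Re (f x)) (complex.Re l) /\
  is_derive s 1 (fun x => complex.Im (f x)) (complex.Im l).
Proof.
move=> As fl.
(* The real and imaginary parts are treated together, as a 1-Lipschitz map [p] compatible with
   differences and with division by reals. *)
have K (p : R[i] -> R) : (forall x y, p (x - y) = p x - p y) ->
    (forall (x : R) y, p (y / x%:C) = x^-1 * p y) ->
    (forall y, `|p y| <= normc y) -> is_derive s 1 (fun x => p (f x)) (p l).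
  move=> pB pM pn.
  suff H : h^-1 *: (p (f (h *: 1 + s)) - p (f s)) @[h --> 0^'] --> p l.
    apply: DeriveDef; first exact: (cvgP _ H).
    exact: (cvg_lim _ H).
  apply/cvgrPdistC_le => e e0.
  have [d /= d0 dP] := (nbhs_ballP _ _).1 As.
  have [d' /= d0' dP'] := (nbhs_ballP _ _).1 (fl _ e0).
  rewrite near_withinE; apply/nbhs_ballP; exists (Num.min d d') => /=.
    by rewrite lt_min d0 d0'.
  move=> h; rewrite /ball /= sub0r normrN lt_min => /andP[hd hd'] h0.
  have E : ball s d (h + s) by rewrite /ball /= opprD addrCA addrN addr0 normrN.
  have E' : ball s d' (h + s) by rewrite /ball /= opprD addrCA addrN addr0 normrN.
  have hs : h + s != s by rewrite -subr_eq0 addrK.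
  have := dP' _ E' hs (dP _ E); rewrite /= addrK => /ltW; apply: le_trans.
  have -> : h *: 1 + s = h + s by rewrite [_ *: _]mulr1.
  by apply: le_trans (pn _); rewrite pB pM pB.
split; apply: K => //.
- by move=> x y; rewrite raddfB.
- by move=> x [a b]; rewrite mulrC -[(x%:C)^-1]fmorphV /= mul0r subr0.
- exact: Re_le_normc.
- by move=> x y; rewrite raddfB.
- by move=> x [a b]; rewrite mulrC -[(x%:C)^-1]fmorphV /= mul0r addr0.
- exact: Im_le_normc.
Qed.

Lemma ccvg_within_nbhs (A : set R) (f : R -> R[i]) s :
  ccvg (within A s^') f (f s) -> ccvg (within A (nbhs s)) f (f s).
Proof.
move=> fs e e0; apply: (@filterS _ (nbhs s) _ _ _ _ (fs e e0)) => x H Ax.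
have [->|xs] := eqVneq x s.
  by rewrite subrr normc0.
exact: H.
Qed.

(** Cauchy-Schwarz, read off from the real part of [z * w^*]. *)
Lemma ReM_ImM_le (z w : R[i]) :
  complex.Re z * complex.Re w + complex.Im z * complex.Im w <= normc z * normc w.
Proof.
have -> : normc w = normc w^* by case: w => a b /=; rewrite sqrrN.
rewrite -normcM; apply: le_trans (Re_le_normc _); apply: le_trans (ler_norm _).
by case: z w => a b [c d] /=; rewrite mulrN opprK.
Qed.

(** The squared modulus of [phi], which stays differentiable at the zeros of [phi], is multiplied by
    [expR (- 2 * C * x)]; the product has nonpositive derivative and starts at 0. *)
Lemma gronwall0 (phi dphi : R -> R[i]) (a b C : R) : phi a = 0 ->
  (forall s, a <= s <= b -> cderiv `[a, b] phi s (dphi s)) ->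
  (forall s, a < s < b -> normc (dphi s) <= C * normc (phi s)) ->
  forall s, a <= s <= b -> phi s = 0.
Proof.
move=> pa hphi dle s /andP[sa sb].
pose u (x : R) : R := complex.Re (phi x); pose v (x : R) : R := complex.Im (phi x).
pose N (x : R) : R := expR (- 2 * C * x) * (u x * u x + v x * v x).
have cphi x : x \in `[a, b] -> ccvg (within `[a, b] (nbhs x)) phi (phi x).
  by rewrite in_itv /= => xab; apply/ccvg_within_nbhs/cderiv_cvg/hphi.
have dN x : x \in `]a, b[ -> is_derive x 1 N (expR (- 2 * C * x) *
   (2 * (u x * complex.Re (dphi x) + v x * complex.Im (dphi x)) - 2 * C * (u x * u x + v x * v x))).
  move=> xab; have nx : nbhs x `[a, b]%classic.
    have H : \forall z \near x, z \in `]a, b[ by exact: near_in_itvoo.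
    move: H; apply: filterS => y.
    exact: subset_itv_oo_cc.
  have xab' : a <= x <= b by move: xab; rewrite in_itv /= => /andP[/ltW -> /ltW ->].
  have [du dv] := is_derive_cderiv nx (hphi _ xab').
  apply: is_derive_eq; rewrite /= -/(u x) -/(v x).
  by rewrite /GRing.scale /=; ring.
have cN : {within `[a, b], continuous N}.
  apply/subspace_continuousP => x xab.
  have cu : u @ within `[a, b] (nbhs x) --> u x by apply: cvg_Re; exact: cphi.
  have cv : v @ within `[a, b] (nbhs x) --> v x by apply: cvg_Im; exact: cphi.
  apply: cvgM; last by apply: cvgD; apply: cvgM.
  apply: cvg_within_filter.
  have ce : (fun y => - 2 * C * y) @ x --> - 2 * C * x.
    by apply: cvgM; [exact: cvg_cst|exact: cvg_id].
  exact: (cvg_comp _ _ ce (@continuous_expR R _)).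
have dN1 x : x \in `]a, b[ -> derivable N x 1 by move=> /dN [].
have dN2 x : x \in `]a, b[ -> derive1 N x <= 0.
  move=> xab; have [dx dN'] := dN x xab; rewrite derive1E dN'.
    rewrite mulr_ge0_le0 ?expR_ge0//.
    move: xab; rewrite in_itv /= => /dle H.
    have H1 := ReM_ImM_le (phi x) (dphi x).
    have H2 := ler_wpM2l (ger0_normc (phi x)) H.
    have H3 : normc (phi x) * (C * normc (phi x)) = C * (u x * u x + v x * v x).
      by rewrite /u /v -!expr2 -normc_sqr; ring.
    rewrite H3 in H2; rewrite /u /v in H2 *; lra.
have Ns : N s <= N a.
  apply: (@ler0_derive1_le_cc R N a b dN1 dN2 cN) => //; rewrite in_itv /=.
    by rewrite sa.
  by rewrite lexx (le_trans sa).
have : N s <= 0 by rewrite (le_trans Ns)// /N /u /v pa !mul0r addr0 mulr0.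
rewrite pmulr_rle0 ?expR_gt0// => H.
apply/eqP; rewrite -normc_eq0 -sqrf_eq0 eq_le sqr_ge0 andbT normc_sqr !expr2.
exact: H.
Qed.

End Gronwall.

Section GronwallLocal.
Context {R : realType}.

(** The constant may depend on the point and serve only just after it, since the Lipschitz bounds
    available for the Loewner field blow up at the circle. If the supremum of the times up to which
    [phi] vanishes were below [t], [gronwall0] would extend the vanishing beyond it. *)
Lemma gronwall_local (phi dphi : R -> R[i]) (t : R) : phi 0 = 0 ->
  (forall s, 0 <= s <= t -> cderiv `[0, t] phi s (dphi s)) ->
  (forall s, 0 <= s < t -> phi s = 0 -> exists C : R, exists2 d : R, 0 < d &
     forall r, s < r < s + d -> r < t -> normc (dphi r) <= C * normc (phi r)) ->
  forall s, 0 <= s <= t -> phi s = 0.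
Proof.
move=> p0 hphi hloc s0 /andP[s00 s0t].
pose S := [set s | 0 <= s <= t /\ forall r, 0 <= r <= s -> phi r = 0].
have S0 : S 0.
  split; first by rewrite lexx (le_trans s00).
  by move=> r /andP[r0 r1]; rewrite (_ : r = 0)//; apply/le_anti; rewrite r0 r1.
have ubS : has_ubound S by exists t => x [/andP[]].
have supS : has_sup S by split => //; exists 0.
pose sg := sup S.
have sg0 : 0 <= sg by apply: ub_le_sup.
have sgt : sg <= t by apply: ge_sup => [|x [/andP[]]//]; exists 0.
have below r : 0 <= r < sg -> phi r = 0.
  move=> /andP[r0 rs].
  have := @sup_adherent R S (sg - r); rewrite subr_gt0 => /(_ rs supS)[x Sx].
  rewrite opprB addrC subrK => rx; case: Sx => _; apply; rewrite r0; exact: ltW.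
(* By continuity, a nonzero value at [sg] would keep [phi] from vanishing just below [sg]. *)
have psg : phi sg = 0.
  apply/eqP/negPn/negP => psg.
  have sgp : 0 < sg by rewrite lt_neqAle sg0 andbT; apply/eqP => E; move: psg; rewrite -E p0 eqxx.
  have n0 : 0 < normc (phi sg) by rewrite lt_neqAle ger0_normc eq_sym normc_eq0 psg.
  have sgi : 0 <= sg <= t by rewrite sg0 sgt.
  have [d /= d0 dP] := (nbhs_ballP _ _).1 (cderiv_cvg (hphi _ sgi) n0).
  pose x := Num.max 0 (sg - d / 2).
  have xs : x < sg by rewrite gt_max sgp gtrBl divr_gt0.
  have x0 : 0 <= x by rewrite le_max lexx.
  have : normc (phi x - phi sg) < normc (phi sg).
    apply: dP.
    - rewrite /ball /= ger0_norm ?subr_ge0 ?(ltW xs)//.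
      rewrite ltrBlDr -ltrBlDl lt_max; apply/orP; right.
      by rewrite ltrD2l ltrN2 ltr_pdivrMr// mulr_natr mulr2n ltrDl.
    - by rewrite lt_eqF.
    - by rewrite /= in_itv /= x0 (le_trans (ltW xs)).
  by rewrite (below x) ?x0// sub0r normc_opp ltxx.
have {}below r : 0 <= r <= sg -> phi r = 0.
  move=> /andP[r0]; rewrite le_eqVlt => /predU1P[->//|rs]; apply: below.
  by rewrite r0.
have [sglt|tsg] := ltP sg t; last first.
  by apply: below; rewrite s00 (le_trans s0t).
have sgt' : 0 <= sg < t by rewrite sg0.
have [C [d d0 dC]] := hloc _ sgt' psg.
pose b := Num.min t (sg + d).
have sb : sg < b by rewrite lt_min sglt ltrDl.
have bt : b <= t by rewrite ge_min lexx.
have bd : b <= sg + d by rewrite ge_min lexx orbT.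
have G := @gronwall0 R phi dphi sg b C psg.
have Sb : S b.
  split; first by rewrite (le_trans sg0 (ltW sb)).
  move=> r /andP[r0 rb]; have [rs|sr] := leP r sg; first by apply: below; rewrite r0.
  apply: G; last by rewrite (ltW sr).
    move=> s /andP[s1 s2]; apply: (cderiv_subset (A := `[0, t]%classic)).
      move=> y /=; rewrite !in_itv /= => /andP[y0 y1].
      by rewrite (le_trans sg0)// (le_trans y1).
    by apply: hphi; rewrite (le_trans sg0)// (le_trans s2).
  move=> s /andP[s1 s2]; apply: dC; last exact: lt_le_trans bt.
  by rewrite s1 (lt_le_trans s2).
by have := ub_le_sup ubS Sb; rewrite leNgt sb.
Qed.

End GronwallLocal.

(** * The Lambert function on the cut plane *)

Section Lambert.
Context {R : realType}.
Implicit Types z a : R[i].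

(** Caratheodory's form of differentiability: the difference quotient, completed at [a] by the
    derivative, is continuous there. *)
Lemma derivable_slope (f : R[i] -> R[i]) a : derivable f a 1 ->
  exists2 Psi : R[i] -> R[i], (forall y, f y - f a = Psi y * (y - a)) &
    ccvg (nbhs a) Psi (Psi a) /\ Psi a = derive1 f a.
Proof.
move=> df; pose l := derive1 f a.
have fl : ccvg (0 : R[i])^' (fun h : R[i] => h^-1 * (f (h + a) - f a)) l.
  have : h^-1 *: (f (h *: 1 + a) - f a) @[h --> (0 : R[i])^'] --> l.
    by rewrite /l derive1E; exact: df.
  move=> /ccvgP; apply: ccvg_eq; apply: filterE => h.
  by rewrite [h *: 1]mulr1.
exists (fun y => if y == a then l else (f y - f a) / (y - a)).
  move=> y; case: eqP => [->|/eqP ya]; first by rewrite !subrr mulr0.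
  by rewrite divfK// subr_eq0.
rewrite eqxx; split=> // e e0.
have [d /= d0 dP] := (nbhs_ballP _ _).1 (fl _ e0).
apply/nbhs_ballP; exists d => //= y ay.
have [ya|ya] := eqVneq y a; first by rewrite subrr normc0.
have := dP (y - a); rewrite subrK mulrC; apply; last by rewrite subr_eq0.
by move: ay; rewrite /ball /= sub0r normrN distrC.
Qed.

Lemma derivable_ccvg (f : R[i] -> R[i]) a : derivable f a 1 -> ccvg (nbhs a) f (f a).
Proof.
move=> /derivable_slope[Psi fP [cP _]].
have E : f a = Psi a * (a - a) + f a by rewrite subrr mulr0 add0r.
have cid : ccvg (nbhs a) id a by apply/ccvgP; exact: cvg_id.
rewrite [X in ccvg _ _ X]E.
apply: ccvg_eq (ccvgD (ccvgM cP (ccvgB cid (ccvg_cst a))) (ccvg_cst (f a))).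
by apply: filterE => y; rewrite -fP subrK.
Qed.

Lemma cderiv_derivable (A : set R) (f : R -> R[i]) (Phi : R[i] -> R[i]) s l :
  cderiv A f s l -> derivable Phi (f s) 1 ->
  cderiv A (fun x => Phi (f x)) s (derive1 Phi (f s) * l).
Proof.
move=> fl /derivable_slope[Psi fP [cP <-]].
apply: (cderiv_comp fl); first by apply: filterE => x.
exact: ccvg_comp (cderiv_cvg fl) cP.
Qed.

(** The real part equals [(1 - |z|^2) / |1 - z|^2]. *)
Lemma Re_cayley_gt0 z : normc z < 1 -> 0 < complex.Re ((1 + z) / (1 - z)).
Proof.
move=> z1; have z1' : normc z ^+ 2 < 1 by rewrite expr_lt1 ?ger0_normc.
rewrite normc_sqr in z1'.
case: z z1 z1' => x y z1 /= z1'.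
set n := (1 - x) ^+ 2 + (0 - y) ^+ 2.
have n0 : 0 < n.
  have x1 : x < 1.
    have := Re_le_normc (x +i* y); rewrite /= => H.
    by apply: le_lt_trans z1; apply: le_trans H; exact: ler_norm.
  by rewrite ltr_wpDr ?sqr_ge0// exprn_gt0// subr_gt0.
have -> : (1 + x) * ((1 - x) / n) - (0 + y) * - ((0 - y) / n) = (1 - (x ^+ 2 + y ^+ 2)) / n.
  by field; rewrite gt_eqF.
by rewrite divr_gt0// subr_gt0.
Qed.

Lemma disk_neq1 z : normc z < 1 -> 1 - z != 0.
Proof.
move=> z1; apply/eqP => /subr0_eq E; move: z1; rewrite -E.
by rewrite normc1 ltxx.
Qed.

Lemma cayley_sqr z : normc z < 1 ->
  ((1 + z) / (1 - z)) ^+ 2 = 1 + 4 * (z / (1 - z) ^+ 2).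
Proof. by move=> /disk_neq1 z1; field. Qed.

Lemma slit_plane_koebe z : normc z < 1 -> slit_plane (1 + 4 * (z / (1 - z) ^+ 2)).
Proof. by move=> z1; rewrite -cayley_sqr//; apply/slit_plane_sqr/Re_cayley_gt0. Qed.

(** This is [1 + (s - 1) <= expR (s - 1)] multiplied by [expR (- s)]. *)
Lemma mul_expRN_le (s : R) : s * expR (- s) <= expR (- 1).
Proof.
have := expR_ge1Dx (s - 1); rewrite addrC subrK => H.
apply: le_trans (ler_wpM2r (expR_ge0 (- s)) H) _.
by rewrite -expRD [s - 1]addrC -addrA subrr addr0.
Qed.

(** The argument is [s * expR (- s)] times [4 z / (1 - z)^2]. The first factor lies between 0 and
    [expR (-1)], so on the cut the second would be a real number at most -1, which
    [slit_plane_koebe] excludes. *)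
Lemma lambert_plane_zeta (s : R) z : 0 <= s -> normc z < 1 ->
  lambert_plane (Lambda s z * (expR (- s))%:C).
Proof.
move=> s0 z1 [].
have -> : Lambda s z * (expR (- s))%:C = (s * expR (- s))%:C * (4 * (z / (1 - z) ^+ 2)).
  by rewrite /Lambda rmorphM; ring.
have := slit_plane_koebe z1; move: (4 * _) => [x y].
rewrite /slit_plane /= !mul0r subr0 addr0 add0r => sk /eqP.
have e0 : 0 < expR (-1) :> R by exact: expR_gt0.
have sl := mul_expRN_le s.
rewrite !mulf_eq0 (gt_eqF (expR_gt0 (- s))) orbF => /orP[/eqP ->|/eqP y0].
  by rewrite !mul0r lerNr oppr0 leNgt e0.
move=> H; apply: sk; split=> //; rewrite addrC -lerBrDr sub0r.
have se0 : 0 <= s * expR (- s) by rewrite mulr_ge0 ?expR_ge0.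
rewrite leNgt; apply/negP => x1.
have [x0|x0] := leP 0 x.
  have : 0 <= s * expR (- s) * x by rewrite mulr_ge0.
  by move=> K; lra.
have K1 : s * expR (- s) * (- x) <= expR (- 1) * (- x).
  by rewrite ler_wpM2r// oppr_ge0 ltW.
have K2 : expR (-1) * (- x) < expR (-1) * 1.
  by rewrite ltr_pM2l// ltrNl.
lra.
Qed.

Context {W0 : R[i] -> R[i]} (hW : principal_lambert W0).

Lemma ccvg_W0 z : lambert_plane z -> ccvg (nbhs z) W0 (W0 z).
Proof. by move=> zl; apply/derivable_ccvg/(lambert_holomorphic hW). Qed.

Lemma lambert_plane_small z : normc z < expR (-1) -> lambert_plane z.
Proof.
move=> z1 [zi]; apply/negP; rewrite -ltNge.
have := Re_le_normc z; rewrite ler_norml => /andP[H _].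
by apply: lt_le_trans H; rewrite ltrN2.
Qed.

(** The partial sums of the series at a real point are real. *)
Lemma Im_W0_real (x : R) : `|x| < expR (-1) -> complex.Im (W0 x%:C) = 0.
Proof.
move=> x1.
have /(lambert_series hW) : `|x%:C| < (expR (-1))%:C.
  have : normc x%:C < expR (-1) by rewrite normc_real.
  by rewrite -ltcR.
move=> /ccvgP H.
have c0 : (fun n : nat => (0 : R)) @ \oo --> (0 : R) by exact: cvg_cst.
have c1 := cvg_Im H _.
apply: (cvg_unique _ (c1 _)) => //.
apply: cvg_trans c0; apply: near_eq_cvg; apply: nearW => n.
rewrite /series /=.
set S := \sum_(_ <= _ < _) _.
suff /complex_realP[k ->] : S \is Num.real by [].
apply: rpred_sum => i _.
apply: rpredM; first apply: rpredM.
- by rewrite rpredX// rpredN rpred_nat.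
- by rewrite rpredV rpred_nat.
- by rewrite rpredX//; apply/complex_realP; exists x.
Qed.

(** The value -1 would force [z = - expR (-1)], the endpoint of the cut. *)
Lemma W0_neqN1 z : lambert_plane z -> W0 z != -1.
Proof.
move=> zl; apply/eqP => E; have := lambert_inverse hW zl; rewrite E.
rewrite -(rmorph1 (real_complex R)) -rmorphN cexp_real -rmorphM => H.
by apply: zl; rewrite -H /= mulN1r.
Qed.

(** Along the segment from 0 to [x], [W0] is real, continuous and starts at 0; to reach -1 or below
    it would have to take the value -1, against [W0_neqN1]. *)
Lemma Re_W0_real (x : R) : `|x| < expR (-1) -> -1 < complex.Re (W0 x%:C).
Proof.
move=> x1; rewrite ltNge; apply/negP => H.
pose r (y : R) : R := complex.Re (W0 (y * x)%:C).
have small y : y \in `[0, 1] -> `|y * x| < expR (-1).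
  rewrite in_itv /= => /andP[y0 y1]; apply: le_lt_trans x1.
  by rewrite normrM ger0_norm// ler_piMl.
have cr : {within `[0, 1], continuous r}.
  apply/subspace_continuousP => y yI; apply: cvg_within_filter.
  apply: cvg_Re; apply: (@ccvg_comp R R _ _ (fun y => (y * x)%:C) (y * x)%:C).
    apply: ccvg_real; apply: cvgM; [exact: cvg_id|exact: cvg_cst].
  by apply/ccvg_W0/lambert_plane_small; rewrite normc_real small.
have r0 : r 0 = 0 by rewrite /r mul0r (lambert0 hW).
have r1 : r 1 <= -1 by rewrite /r mul1r.
have r01 : Num.min (r 0) (r 1) <= -1 <= Num.max (r 0) (r 1).
  by rewrite r0 ge_min le_max r1 orbT /= lerN10.
have [c cI rc] := @IVT R r 0 1 (-1) ler01 cr r01.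
have cl : lambert_plane (c * x)%:C.
  by apply/lambert_plane_small; rewrite normc_real small.
have /eqP := W0_neqN1 cl; apply.
have := Im_W0_real (small _ cI); move: rc; rewrite /r.
by case: (W0 _) => a b /= -> ->; apply/eqP; rewrite eq_complex /= oppr0 !eqxx.
Qed.

End Lambert.

(** * The explicit flow *)

Section Cayley.
Context {R : realType}.
Implicit Types m : R[i].

Lemma Re_gt0_addr1_neq0 m : 0 < complex.Re m -> m + 1 != 0.
Proof. by move=> m0; apply: Re_gt0_neq0; rewrite raddfD /= addr_gt0. Qed.

(** The squared moduli of [m + 1] and [m - 1] differ by four times the real part of [m]. *)
Lemma normc_cayley_lt1 m : 0 < complex.Re m -> normc ((m - 1) / (m + 1)) < 1.
Proof.
move=> m0; have n0 := Re_gt0_addr1_neq0 m0.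
have k0 : 0 < normc (m + 1) by rewrite lt_neqAle ger0_normc eq_sym normc_eq0 n0.
rewrite normcM normcV ltr_pdivrMr// mul1r.
rewrite -(ltr_pXn2r (n := 2)) ?nnegrE ?ger0_normc// !normc_sqr.
case: m m0 {n0 k0} => x y /= x0; rewrite oppr0 addr0 ltrD2r.
have -> : (x + 1) ^+ 2 = (x - 1) ^+ 2 + 4 * x by ring.
by rewrite ltrDl mulr_gt0.
Qed.

Lemma cayleyK m : 0 < complex.Re m ->
  (1 + (m - 1) / (m + 1)) / (1 - (m - 1) / (m + 1)) = m.
Proof.
move=> m0; have n0 := Re_gt0_addr1_neq0 m0.
field; rewrite n0 /=.
have -> : m + 1 - (m - 1) = 2 by ring.
by rewrite pnatr_eq0.
Qed.

Lemma cayleyVK (z : R[i]) : normc z < 1 ->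
  ((1 + z) / (1 - z) - 1) / ((1 + z) / (1 - z) + 1) = z.
Proof.
move=> /disk_neq1 z1; field; rewrite z1 /=.
have -> : 1 + z + (1 - z) = 2 by ring.
by rewrite pnatr_eq0.
Qed.

End Cayley.

(** Each point of a nondegenerate interval is an accumulation point of it, which makes derivatives
    within the interval unique. *)
Lemma within_itv_proper (R : realType) (s t : R) : 0 < t -> 0 <= s <= t ->
  ProperFilter (within `[0, t] s^').
Proof.
move=> t0 /andP[s0 st]; apply: Build_ProperFilter_ex => P.
move=> /(nbhs_ballP _ _).1[d /= d0 dP].
have [st'|ts] := ltP s t.
- pose x := Num.min t (s + d / 2).
  have sx : s < x by rewrite lt_min st' ltrDl divr_gt0.
  have xt : x <= t by rewrite ge_min lexx.
  exists x; apply: dP.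
  + rewrite /ball /= distrC ger0_norm ?subr_ge0 ?(ltW sx)//.
    rewrite ltrBlDl gt_min; apply/orP; right.
    by rewrite ltrD2l ltr_pdivrMr// mulr_natr mulr2n ltrDl.
  + by rewrite gt_eqF.
  + by rewrite /= in_itv /= (le_trans s0 (ltW sx)).
- have sE : s = t by apply/le_anti; rewrite st ts.
  pose x := Num.max 0 (s - d / 2).
  have xs : x < s by rewrite gt_max gtrBl divr_gt0// andbT sE.
  have x0 : 0 <= x by rewrite le_max lexx.
  exists x; apply: dP.
  + rewrite /ball /= ger0_norm ?subr_ge0 ?(ltW xs)//.
    rewrite ltrBlDr -ltrBlDl lt_max; apply/orP; right.
    by rewrite ltrD2l ltrN2 ltr_pdivrMr// mulr_natr mulr2n ltrDl.
  + by rewrite lt_eqF.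
  + by rewrite /= in_itv /= x0 (le_trans (ltW xs)).
Qed.

Section LambertFlow.
Context {R : realType} (W0 : R[i] -> R[i]) (hW : principal_lambert W0).
Implicit Types (s t : R) (z : R[i]).

(* [flow_u s z] is the starting point of the characteristic of the Burgers
   equation that is at [flow s z] at time [s], and [flow_m s z] is the value
   of the Herglotz transform along it; [flow_q] stands for [flow_w / s], in a
   form that makes sense at [s = 0]. *)
Definition koebe z := z / (1 - z) ^+ 2.
Definition flow_w s z := W0 (Lambda s z * (expR (- s))%:C).
Definition flow_q s z := 4 * koebe z * cexp (- s%:C - flow_w s z).
Definition flow_m s z := sqrtc (1 + flow_q s z).
Definition flow_u s z := (flow_m s z - 1) / (flow_m s z + 1).
Definition flow s z := flow_u s z * cexp (2 * s%:C * flow_m s z).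

(** The equation [w e^w = Lambda_s(z) e^(-s)] is multiplied by [e^(-w)]; nothing is divided by [s],
    so [s = 0] is included. *)
Lemma flow_wE s z : 0 <= s -> normc z < 1 -> flow_w s z = s%:C * flow_q s z.
Proof.
move=> s0 z1; have := lambert_inverse hW (lambert_plane_zeta s0 z1).
rewrite -/(flow_w s z) => H.
have -> : flow_w s z = flow_w s z * cexp (flow_w s z) * cexp (- flow_w s z).
  by rewrite -mulrA -cexpD subrr cexp0 mulr1.
rewrite H /flow_q cexpD -rmorphN cexp_real /Lambda /koebe; ring.
Qed.

(** This is the denominator produced by implicit differentiation in [cderiv_flow]. *)
Lemma flow_wD1_neq0 s z : 0 <= s -> normc z < 1 -> 1 + flow_w s z != 0.
Proof.
move=> s0 z1; rewrite addrC -[X in _ + X]opprK subr_eq0.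
exact/(W0_neqN1 hW)/lambert_plane_zeta.
Qed.

(** Suppose [q = - p] with [p >= 1], so that [w = - s p]. Then [4 koebe z] is a real number [c], and
    [c > -1] by [slit_plane_koebe]. The argument of [W0] is then real and small, so [w > -1], that
    is [s p < 1]; these bounds contradict the formula for [c]. *)
Lemma slit_plane_flow_q s z : 0 <= s -> normc z < 1 -> slit_plane (1 + flow_q s z).
Proof.
move=> s0 z1 [qi qr].
pose p := 1 - complex.Re (1 + flow_q s z).
have p1 : 1 <= p by rewrite /p lerDl oppr_ge0.
have qE : flow_q s z = (- p)%:C.
  have -> : flow_q s z = 1 + flow_q s z - 1 by rewrite addrC addKr.
  rewrite /p opprB; move: qi; case: (1 + flow_q s z) => a b /= ->.
  by apply/eqP; rewrite eq_complex /= subr0 !eqxx.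
(* The value of [4 * koebe z] obtained by solving the definition of [flow_q] for it. *)
pose c := - p * expR (s * (1 - p)).
have kE : 4 * koebe z = c%:C.
  have -> : 4 * koebe z = flow_q s z * cexp (s%:C + flow_w s z).
    rewrite /flow_q -mulrA -cexpD [- _ - _ + _](_ : _ = 0) ?cexp0 ?mulr1//.
    by ring.
  rewrite flow_wE// qE -rmorphM -rmorphD cexp_real -rmorphM /c.
  by congr (_%:C); congr (_ * expR _); ring.
have := slit_plane_koebe z1; rewrite -/(koebe z) kE /slit_plane /= addr0 => sk.
have c1 : -1 < c by rewrite ltNge; apply/negP => c1; apply: sk; split=> //; lra.
have c0 : c <= 0 by rewrite /c mulr_le0_ge0 ?expR_ge0// oppr_le0; lra.
have zE : Lambda s z * (expR (- s))%:C = (s * expR (- s) * c)%:C.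
  have -> : (s * expR (- s) * c)%:C = s%:C * (expR (- s))%:C * c%:C by rewrite -!rmorphM.
  by rewrite -kE /Lambda /koebe; ring.
have small : `|s * expR (- s) * c| < expR (-1).
  have sl := mul_expRN_le s; have e0 := expR_gt0 (-1 : R).
  have se0 : 0 <= s * expR (- s) by rewrite mulr_ge0 ?expR_ge0.
  rewrite normrM (ger0_norm se0) (ler0_norm c0).
  apply: (@le_lt_trans _ _ (expR (-1) * - c)); first by rewrite ler_wpM2r// oppr_ge0.
  by rewrite -[ltRHS]mulr1 ltr_pM2l// ltrNl.
have := Re_W0_real hW small; rewrite -zE -/(flow_w s z) flow_wE// qE -rmorphM /= => sp.
have E := expR_ge1Dx (s * (1 - p)).
have K1 : p * (1 + s * (1 - p)) <= p * expR (s * (1 - p)).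
  by rewrite ler_wpM2l//; lra.
(* The product equals [p * (1 + s * (1 - p)) - 1], so [K1] yields [c <= -1]. *)
have K2 : 0 <= (1 - s * p) * (p - 1) by rewrite mulr_ge0//; lra.
rewrite /c in c1; nra.
Qed.

Lemma flow_m_sqr s z : flow_m s z ^+ 2 = 1 + flow_q s z.
Proof. exact: sqr_sqrtc. Qed.

Lemma Re_flow_m_gt0 s z : 0 <= s -> normc z < 1 -> 0 < complex.Re (flow_m s z).
Proof. by move=> s0 z1; apply/Re_sqrtc_gt0/slit_plane_flow_q. Qed.

Lemma flow0 z : normc z < 1 -> flow 0 z = z.
Proof.
move=> z1; have w0 : flow_w 0 z = 0.
  by rewrite /flow_w /Lambda mulr0 !mul0r (lambert0 hW).
rewrite /flow mulr0 mul0r cexp0 mulr1 /flow_u /flow_m /flow_q w0 subr0 oppr0 cexp0 mulr1.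
by rewrite -cayley_sqr// sqrtc_sqr ?Re_cayley_gt0// cayleyVK.
Qed.

(** Since [w / s = q], the root in the formula is [m]; since [q = (m - 1) (m + 1)], the bracket
    reduces to [1 - 2 / (m + 1)], which is [flow_u]. *)
Lemma flow_formula s z : 0 < s -> normc z < 1 -> z != 0 ->
  lambert_formula W0 s z = flow s z.
Proof.
move=> s0 z1 z0; have m0 := Re_flow_m_gt0 (ltW s0) z1.
have sC : s%:C != 0 by rewrite (inj_eq (@complexI _)) gt_eqF.
have q0 : flow_q s z != 0.
  apply: mulf_neq0; last exact: cexp_neq0.
  apply: mulf_neq0; first by rewrite pnatr_eq0.
  by rewrite /koebe mulf_neq0// invr_neq0// expf_neq0// disk_neq1.
have wq : flow_w s z / s%:C = flow_q s z by rewrite flow_wE ?(ltW s0)// mulrC mulKf.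
have -> : lambert_formula W0 s z =
    (1 + 2 * s%:C / flow_w s z * (1 - flow_m s z)) * cexp (2 * s%:C * flow_m s z).
  by rewrite /flow_m -wq.
rewrite /flow /flow_u; congr (_ * _).
rewrite flow_wE ?(ltW s0)//.
have qE : flow_q s z = (flow_m s z - 1) * (flow_m s z + 1).
  by rewrite -subr_sqr_1 flow_m_sqr addrC addKr.
move: q0; rewrite qE mulf_eq0 negb_or => /andP[k1 k2].
by field; rewrite k1 k2 sC.
Qed.

(** Joint continuity in time and space includes [s = 0] and [z = 0]: the arguments of [W0] and of
    the root stay off their cuts, and no denominator vanishes. *)
Lemma ccvg_flow T (F : set_system T) {FF : Filter F} (f : T -> R) (h : T -> R[i]) s z :
  0 <= s -> normc z < 1 -> f @ F --> s -> ccvg F h z ->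
  ccvg F (fun x => flow (f x) (h x)) (flow s z).
Proof.
move=> s0 z1 fs hz; have m0 := Re_flow_m_gt0 s0 z1.
have n1 := disk_neq1 z1.
have cf : ccvg F (fun x => (f x)%:C) s%:C by exact: ccvg_real.
have ck : ccvg F (fun x => koebe (h x)) (koebe z).
  apply: ccvgM => //; apply: ccvgV; first by rewrite expf_neq0.
  by apply: ccvgM; apply: ccvgB => //; exact: ccvg_cst.
have cw : ccvg F (fun x => flow_w (f x) (h x)) (flow_w s z).
  apply: (ccvg_comp (h := W0)); last exact/(ccvg_W0 hW)/lambert_plane_zeta.
  apply: ccvgM.
    by apply: ccvgM => //; apply: ccvgM => //; exact: ccvg_cst.
  apply: ccvg_real; have cN : (fun x => - f x) @ F --> - s by exact: cvgN.
  exact: (cvg_comp _ _ cN (@continuous_expR R _)).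
have cq : ccvg F (fun x => flow_q (f x) (h x)) (flow_q s z).
  apply: ccvgM; first by apply: ccvgM => //; exact: ccvg_cst.
  by apply: ccvg_cexp; apply: ccvgB => //; exact: ccvgN.
have cm : ccvg F (fun x => flow_m (f x) (h x)) (flow_m s z).
  apply: ccvg_sqrtc; first exact: slit_plane_flow_q.
  by apply: ccvgD => //; exact: ccvg_cst.
apply: ccvgM.
  apply: ccvgM; first by apply: ccvgB => //; exact: ccvg_cst.
  apply: ccvgV; first exact: Re_gt0_addr1_neq0.
  by apply: ccvgD => //; exact: ccvg_cst.
apply: ccvg_cexp; apply: ccvgM => //; apply: ccvgM => //; exact: ccvg_cst.
Qed.

(** Differentiating [w = s q] gives [1 + w' = m^2 / (1 + w)]. The logarithmic derivatives of [u] and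
    of [exp (2 s m)] are then [- m / (1 + w)] and [2 m - w m / (1 + w)], with sum [m]. *)
Lemma cderiv_flow t s z : 0 < t -> 0 <= s <= t -> normc z < 1 ->
  cderiv `[0, t] (flow ^~ z) s (flow_m s z * flow s z).
Proof.
move=> t0 st z1; have PF := within_itv_proper t0 st; have /andP[s0 _] := st.
have m0 := Re_flow_m_gt0 s0 z1.
(* Only the existence of the derivative is taken from the holomorphy of [W0]; its value comes from
   the implicit relation [w1E]. *)
have [w1 dw] : exists w1, cderiv `[0, t] (flow_w ^~ z) s w1.
  eexists; apply: (@cderiv_derivable R `[0, t]%classic (fun x => Lambda x z * (expR (- x))%:C) W0).
    apply: cderivM.
      apply: cderivM; last exact: cderiv_cst.
      by apply: cderivM; [exact: cderiv_cst|exact: cderiv_id].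
    apply: cderiv_eq.
    - by apply: cderiv_cexp; apply: cderivN; exact: cderiv_id.
    - move=> x _; have E : cexp (- x%:C) = (expR (- x))%:C by rewrite -rmorphN cexp_real.
      exact: E.
    - by rewrite /= in_itv.
    - by [].
  exact/(lambert_holomorphic hW)/lambert_plane_zeta.
have dq : cderiv `[0, t] (flow_q ^~ z) s (- flow_q s z * (1 + w1)).
  apply: (cderiv_eq (f := fun x => 4 * koebe z * cexp (- x%:C - flow_w x z))).
  - apply: cderivM; first exact: cderiv_cst.
    by apply: cderiv_cexp; apply: cderivB; [apply: cderivN; exact: cderiv_id|exact: dw].
  - by move=> x _.
  - by rewrite /= in_itv.
  - by rewrite /flow_q; ring.
have w1E : w1 = flow_q s z + s%:C * (- flow_q s z * (1 + w1)).
  apply: (cderiv_unique PF dw); apply: cderiv_eq.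
  - exact: cderivM (cderiv_id _ _) dq.
  - move=> x; rewrite /= in_itv /= => /andP[x0 _]; by rewrite flow_wE.
  - by rewrite /= in_itv.
  - by rewrite mul1r.
have dm : cderiv `[0, t] (flow_m ^~ z) s ((0 + - flow_q s z * (1 + w1)) / (2 * flow_m s z)).
  apply: cderiv_sqrtc; last exact: slit_plane_flow_q.
  by apply: cderivD => //; exact: cderiv_cst.
have m1 := Re_gt0_addr1_neq0 m0.
apply: (cderiv_eq (f := fun x => (flow_m x z - 1) * (flow_m x z + 1)^-1
                             * cexp (2 * x%:C * flow_m x z))).
- apply: cderivM.
    apply: cderivM; first by apply: cderivB; [exact: dm|exact: cderiv_cst].
    apply: cderivV; last exact: m1.
    by apply: cderivD; [exact: dm|exact: cderiv_cst].
  apply: cderiv_cexp; apply: cderivM; last exact: dm.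
  by apply: cderivM; [exact: cderiv_cst|exact: cderiv_id].
- by move=> x _.
- by rewrite /= in_itv.
- have mn0 := Re_gt0_neq0 m0.
  have wn0 := flow_wD1_neq0 s0 z1; rewrite flow_wE// in wn0.
  have qE : flow_q s z = flow_m s z ^+ 2 - 1 by rewrite flow_m_sqr addrC addKr.
  have w1E' : 1 + w1 = flow_m s z ^+ 2 / (1 + s%:C * flow_q s z).
    apply: (mulIf wn0); rewrite divfK// flow_m_sqr.
    have -> : (1 + w1) * (1 + s%:C * flow_q s z) =
      1 + w1 + s%:C * flow_q s z * (1 + w1) by ring.
    by rewrite {1}w1E; ring.
  rewrite w1E' /flow /flow_u; move: wn0; rewrite qE.
  move=> wn0; field.
  by rewrite m1 mn0 wn0.
Qed.

End LambertFlow.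

(** * Herglotz transforms *)

Section Herglotz.
Context {R : realType} (mu : R -> probability (borelC R) R).
Hypothesis mu_circle : forall t : R, 0 <= t -> mu t (@circle R) = 1%E.

(** For the Herglotz kernel this is [herglotz] by conversion, which [herglotzB] exploits. *)
Definition cintegral (t : R) (f : R[i] -> R[i]) : R[i] :=
  (\int[mu t]_(x in @circle R) complex.Re (f (x : R[i])))
  +i* (\int[mu t]_(x in @circle R) complex.Im (f (x : R[i]))).

Lemma open_circleC : open [set x : R[i] | normc x != 1].
Proof.
rewrite openE => x /= x1; rewrite /interior.
have c : (@normc R) @ x --> normc x.
  by apply: (@cvg_normc R _ (nbhs x) _ id); apply/ccvgP; exact: cvg_id.
have O : open [set y : R | y != 1].
  rewrite (_ : [set y : R | y != 1] = ~` [set 1]); last first.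
    by apply/seteqP; split=> y /=; [move=> /eqP|move=> /eqP].
  by rewrite openC; exact: closed_eq.
exact: (c _ (open_nbhs_nbhs (conj O x1))).
Qed.

Lemma circleP (x : R[i]) : circle x <-> normc x = 1.
Proof.
rewrite /circle /=; split=> [H|H]; last by apply/eqP; rewrite -[`|x|]/((normc x)%:C) H.
by apply: complexI; exact: H.
Qed.

Lemma measurable_circle : measurable (@circle R : set (borelC R)).
Proof.
have -> : (@circle R : set (borelC R)) = ~` [set x : R[i] | normc x != 1].
  apply/seteqP; split=> x /= => [/circleP ->|/negP]; first by rewrite eqxx.
  by rewrite negbK => /eqP /circleP.
apply: measurableC; apply: sub_sigma_algebra; exact: open_circleC.
Qed.

(** By continuity at the points of the circle, the preimage of an open interval has the same trace
    on the circle as its interior. *)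
Lemma measurable_circle_fun (p : R[i] -> R) :
  (forall x : R[i], normc x = 1 -> p @ x --> p x) ->
  measurable_fun (@circle R : set (borelC R)) (p : borelC R -> R).
Proof.
move=> cp; apply: (measurability _ (measurable_realfun.RGenOpens.measurableE R)).
move=> _ [_ [a [b ->] <-]].
pose O : set R[i] := interior (p @^-1` `]a, b[%classic).
have -> : @circle R `&` p @^-1` `]a, b[%classic = @circle R `&` O.
  apply/seteqP; split=> x [cx px]; split=> //; last exact: (interior_subset px).
  move/circleP : (cx) => /cp H; apply: H.
  have px' : p x \in `]a, b[ by exact: px.
  exact: near_in_itvoo px'.
apply: measurableI; first exact: measurable_circle.
by apply: sub_sigma_algebra; exact: open_interior.
Qed.

(* Continuity is tested on full neighbourhoods in the plane, not only along the
   circle. *)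
Definition circle_good (K : R) (f : R[i] -> R[i]) :=
  forall x : R[i], normc x = 1 -> ccvg (nbhs x) f (f x) /\ normc (f x) <= K.

Section Integral.
Variables (t : R) (t0 : 0 <= t).
Local Notation I := (cintegral t).

Lemma real_integrable (K : R) (p : R[i] -> R) :
  (forall x : R[i], normc x = 1 -> p @ x --> p x) ->
  (forall x : R[i], normc x = 1 -> `|p x| <= K) ->
  (mu t).-integrable (@circle R) (EFin \o (p : borelC R -> R)).
Proof.
move=> cp pK; apply: measurable_bounded_integrable.
- exact: measurable_circle.
- by rewrite [X in (X < _)%E](mu_circle t0) ltry.
- exact: measurable_circle_fun.
- exists K; split; first exact: num_real.
  by move=> r Kr x /= /circleP /pK; move/le_trans; apply; exact: ltW.
Qed.

Lemma real_integrableZ (K a : R) (p : R[i] -> R) :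
  (forall x : R[i], normc x = 1 -> p @ x --> p x) ->
  (forall x : R[i], normc x = 1 -> `|p x| <= K) ->
  (mu t).-integrable (@circle R) (EFin \o (fun x : borelC R => a * p x)).
Proof.
move=> cp pK; apply: (@real_integrable (`|a| * K) (fun x => a * p x)) => x x1.
  exact: (@cvgM R R[i] (nbhs x) _ (fun=> a) p a (p x) (cvg_cst a) (cp x x1)).
by rewrite normrM ler_wpM2l// pK.
Qed.

Lemma le_real_integral (K : R) (p : R[i] -> R) :
  (forall x : R[i], normc x = 1 -> p @ x --> p x) ->
  (forall x : R[i], normc x = 1 -> `|p x| <= K) ->
  `|\int[mu t]_(x in @circle R) p (x : R[i])| <= K.
Proof.
move=> cp pK; have ip := real_integrable cp pK.
have mc := measurable_circle.
apply: (le_trans (le_normr_Rintegral mc ip)).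
have -> : K = \int[mu t]_(x in (@circle R : set (borelC R))) K.
  by rewrite Rintegral_cst// [X in fine X](mu_circle t0) /= mulr1.
apply: le_Rintegral => //.
- apply: (@real_integrable K (fun x => `|p x|)) => x x1.
    exact: (@cvg_norm R R R[i] (nbhs x) _ p (p x) (cp x x1)).
  by rewrite normr_id pK.
- apply: (@real_integrable `|K| (fun=> K)) => x x1 //; exact: (@cvg_cst R K R[i] (nbhs x)).
- by move=> x /circleP /pK.
Qed.

Lemma good_Re K f : circle_good K f ->
  (forall x : R[i], normc x = 1 -> (fun y => complex.Re (f y)) @ x --> complex.Re (f x)) /\
  (forall x : R[i], normc x = 1 -> `|complex.Re (f x)| <= K).
Proof.
move=> fK; split=> x /fK[cf fx]; first exact: (@cvg_Re R R[i] (nbhs x) _ f (f x) cf).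
exact: le_trans (Re_le_normc _) fx.
Qed.

Lemma good_Im K f : circle_good K f ->
  (forall x : R[i], normc x = 1 -> (fun y => complex.Im (f y)) @ x --> complex.Im (f x)) /\
  (forall x : R[i], normc x = 1 -> `|complex.Im (f x)| <= K).
Proof.
move=> fK; split=> x /fK[cf fx]; first exact: (@cvg_Im R R[i] (nbhs x) _ f (f x) cf).
exact: le_trans (Im_le_normc _) fx.
Qed.

(** The factor 2 comes from bounding the real and imaginary parts separately. *)
Lemma normc_cintegral K f : circle_good K f -> normc (I f) <= 2 * K.
Proof.
move=> fK; have [r1 r2] := good_Re fK; have [i1 i2] := good_Im fK.
apply: le_trans (normc_le_ReIm _) _; rewrite mulr_natl mulr2n.
exact: lerD (le_real_integral r1 r2) (le_real_integral i1 i2).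
Qed.

Lemma cintegralD K L f g : circle_good K f -> circle_good L g ->
  I (fun x => f x + g x) = I f + I g.
Proof.
move=> fK gL; have mc := measurable_circle.
have [r1 r2] := good_Re fK; have [i1 i2] := good_Im fK.
have [r1' r2'] := good_Re gL; have [i1' i2'] := good_Im gL.
have if1 := real_integrable r1 r2; have if2 := real_integrable i1 i2.
have ig1 := real_integrable r1' r2'; have ig2 := real_integrable i1' i2'.
rewrite /cintegral; apply/eqP; rewrite eq_complex /=; apply/andP; split; apply/eqP.
  under eq_Rintegral do rewrite raddfD; exact: RintegralD.
under eq_Rintegral do rewrite raddfD; exact: RintegralD.
Qed.

Lemma cintegralZ K f (c : R[i]) : circle_good K f -> I (fun x => c * f x) = c * I f.
Proof.
move=> fK; have mc := measurable_circle.
have [r1 r2] := good_Re fK; have [i1 i2] := good_Im fK.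
have if1 := real_integrable r1 r2; have if2 := real_integrable i1 i2.
case: c => a b; rewrite /cintegral; apply/eqP; rewrite eq_complex /=; apply/andP; split; apply/eqP.
  rewrite -(RintegralZl _ mc if1) -(RintegralZl _ mc if2) -RintegralB//.
  - by apply: eq_Rintegral => x _; case: (f x).
  - exact: real_integrableZ r1 r2.
  - exact: real_integrableZ i1 i2.
rewrite -(RintegralZl _ mc if1) -(RintegralZl _ mc if2) -RintegralD//.
- by apply: eq_Rintegral => x _; case: (f x) => u v /=; rewrite addrC.
- exact: real_integrableZ i1 i2.
- exact: real_integrableZ r1 r2.
Qed.

Lemma ccvg_nbhs_id (x : R[i]) : ccvg (nbhs x) id x.
Proof. by apply/ccvgP; exact: cvg_id. Qed.

Lemma good_cst (c : R[i]) : circle_good (normc c) (fun=> c).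
Proof. by move=> x _; split=> //; exact: ccvg_cst. Qed.

Lemma good_id : circle_good 1 id.
Proof. by move=> x x1; split; [exact: ccvg_nbhs_id|rewrite x1]. Qed.

Lemma good_mul K L f g : circle_good K f -> circle_good L g ->
  circle_good (K * L) (fun x => f x * g x).
Proof.
move=> fK gL x x1; have [cf nf] := fK x x1; have [cg ng] := gL x x1.
split; first exact: ccvgM.
by rewrite normcM ler_pM ?ger0_normc.
Qed.

Lemma good_pole (r : R) (z : R[i]) : r < 1 -> normc z <= r ->
  circle_good (1 - r)^-1 (fun x => (x - z)^-1).
Proof.
move=> r1 zr x x1.
have H : 1 - r <= normc (x - z).
  by apply: le_trans (lerB_normc _ _); rewrite x1 lerD2l lerN2.
have r0 : 0 < 1 - r by rewrite subr_gt0.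
have n0 : x - z != 0 by rewrite -normc_eq0 gt_eqF// (lt_le_trans r0).
split.
  by apply: ccvgV => //; apply: ccvgB; [exact: ccvg_nbhs_id|exact: ccvg_cst].
by rewrite normcV lef_pV2 ?posrE// (lt_le_trans r0).
Qed.

Lemma cintegral_eq f g : (forall x, normc x = 1 -> f x = g x) -> I f = I g.
Proof.
move=> fg; rewrite /cintegral; congr (_ +i* _); apply: eq_Rintegral => x;
  by rewrite inE => /circleP /fg ->.
Qed.

(** The divided difference of the Herglotz transform, from the identity [(x + z)/(x - z) - (x +
    w)/(x - w) = (z - w) 2x / ((x - z)(x - w))]; on the diagonal it is the derivative. *)
Definition herglotz_slope (z w : R[i]) : R[i] :=
  I (fun x => 2 * (x * ((x - z)^-1 * (x - w)^-1))).

Lemma good_slope r z w : r < 1 -> normc z <= r -> normc w <= r ->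
  circle_good (2 * (1 * ((1 - r)^-1 * (1 - r)^-1)))
    (fun x => 2 * (x * ((x - z)^-1 * (x - w)^-1))).
Proof.
move=> r1 zr wr; have n2 : normc (2 : R[i]) = 2.
  by rewrite -(rmorph_nat (real_complex R)) normc_real ger0_norm.
rewrite -{1}n2; apply: good_mul; first exact: good_cst.
by apply: good_mul; [exact: good_id|apply: good_mul; exact: good_pole].
Qed.

Lemma good_herglotz r z : r < 1 -> normc z <= r ->
  circle_good ((1 + r) * (1 - r)^-1) (fun x => (x + z) / (x - z)).
Proof.
move=> r1 zr; apply: good_mul; last exact: good_pole.
move=> x x1; split; first by apply: ccvgD; [exact: ccvg_nbhs_id|exact: ccvg_cst].
by apply: le_trans (ler_normcD _ _) _; rewrite x1 lerD2l.
Qed.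

Lemma circleB_neq0 (x z : R[i]) : normc x = 1 -> normc z < 1 -> x - z != 0.
Proof.
by move=> x1 z1; apply/eqP => /subr0_eq E; move: z1; rewrite -E x1 ltxx.
Qed.

Lemma herglotzB r z w : r < 1 -> normc z <= r -> normc w <= r ->
  herglotz mu t z - herglotz mu t w = (z - w) * herglotz_slope z w.
Proof.
move=> r1 zr wr; rewrite -[herglotz mu t z]/(I (fun x => (x + z) / (x - z))).
rewrite -[herglotz mu t w]/(I (fun x => (x + w) / (x - w))).
rewrite /herglotz_slope -(cintegralZ _ (good_slope r1 zr wr)).
apply/eqP; rewrite subr_eq; apply/eqP.
have gs := good_mul (good_cst (z - w)) (good_slope r1 zr wr).
rewrite -(cintegralD gs (good_herglotz r1 wr)).
apply: cintegral_eq => x x1.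
have nz := circleB_neq0 x1 (le_lt_trans zr r1).
have nw := circleB_neq0 x1 (le_lt_trans wr r1).
by field; rewrite nz nw.
Qed.

Lemma normc_herglotz r z : r < 1 -> normc z <= r ->
  normc (herglotz mu t z) <= 2 * ((1 + r) * (1 - r)^-1).
Proof. by move=> r1 zr; exact: normc_cintegral (good_herglotz r1 zr). Qed.

Lemma normc_herglotz_slope r z w : r < 1 -> normc z <= r -> normc w <= r ->
  normc (herglotz_slope z w) <= 4 / (1 - r) ^+ 2.
Proof.
move=> r1 zr wr; apply: le_trans (normc_cintegral (good_slope r1 zr wr)) _.
by rewrite mul1r -invfM -expr2 mulrA -natrM.
Qed.

(** The difference of the kernels is [z - z'] times the first kernel divided by [x - z']. *)
Lemma herglotz_slope_lip r z z' w : r < 1 -> normc z <= r -> normc z' <= r ->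
  normc w <= r ->
  normc (herglotz_slope z w - herglotz_slope z' w) <= 4 / (1 - r) ^+ 3 * normc (z - z').
Proof.
move=> r1 zr zr' wr.
have g3 := good_mul (good_pole r1 zr') (good_slope r1 zr wr).
have -> : herglotz_slope z w - herglotz_slope z' w =
    (z - z') * I (fun x => (x - z')^-1 * (2 * (x * ((x - z)^-1 * (x - w)^-1)))).
  rewrite -(cintegralZ _ g3); apply/eqP; rewrite subr_eq; apply/eqP.
  rewrite -(cintegralD (good_mul (good_cst (z - z')) g3) (good_slope r1 zr' wr)).
  apply: cintegral_eq => x x1.
  have nz := circleB_neq0 x1 (le_lt_trans zr r1).
  have nz' := circleB_neq0 x1 (le_lt_trans zr' r1).
  have nw := circleB_neq0 x1 (le_lt_trans wr r1).
  by field; rewrite nz nz' nw.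
rewrite normcM mulrC ler_wpM2r ?ger0_normc//.
apply: le_trans (normc_cintegral g3) _.
have -> : 2 * ((1 - r)^-1 * (2 * (1 * ((1 - r)^-1 / (1 - r))))) = 4 / (1 - r) ^+ 3 :> R.
  by field; rewrite gt_eqF// subr_gt0.
exact: lexx.
Qed.

End Integral.
End Herglotz.

(** * Characteristics of the Burgers equation *)

Section Characteristics.
Context {R : realType} (mu : R -> probability (borelC R) R).
Hypothesis hmu : hydrodynamic_limit mu.
Local Notation M := (herglotz mu).
Local Notation D := (herglotz_slope mu).
Let mu_circle := hydro_circle hmu.

Lemma near_normc_lt (z : R[i]) r : normc z < r -> nbhs z (fun y => normc y < r).
Proof.
move=> zr; have e0 : 0 < r - normc z by rewrite subr_gt0.
have := @ccvg_nbhs_id R z _ e0; apply: filterS => y /= H.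
have := ler_normcD (y - z) z; rewrite subrK => K; lra.
Qed.

(** The slope from [derivable_slope] and [D t y z] agree for [y != z] near [z], and both are
    continuous at [y = z]; this avoids differentiation under the integral. *)
Lemma derive1_herglotz (t : R) (z : R[i]) : 0 <= t -> normc z < 1 ->
  derive1 (M t) z = D t z z.
Proof.
move=> t0 z1; have dz : derivable (M t) z 1.
  by apply: (burgers_derivable (hydro_burgers hmu)) => //; exact/diskE.
have [Psi PsiE [cPsi <-]] := derivable_slope dz.
pose r := (1 + normc z) / 2.
have zr : normc z < r by rewrite /r; lra.
have r1 : r < 1 by rewrite /r; lra.
pose C := 4 / (1 - r) ^+ 3.
have c1 : ccvg (nbhs z) (fun y => D t y z) (D t z z).
  apply: (@ccvg_norm0 _ _ (nbhs z) _ _ _ (fun y => C * normc (y - z))).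
    have := near_normc_lt zr; apply: filterS => y yr.
    by apply: (herglotz_slope_lip mu_circle t0) => //; exact: ltW.
  rewrite -(mulr0 C).
  have cn : (fun y : R[i] => normc (y - z)) @ z --> (0 : R).
    exact: (@cvg_normcB R R[i] (nbhs z) _ id z (@ccvg_nbhs_id R z)).
  exact: (@cvgM R R[i] (nbhs z) _ (fun=> C) (fun y => normc (y - z)) C 0 (cvg_cst C) cn).
have sub (f : R[i] -> R[i]) a : ccvg (nbhs z) f a -> ccvg z^' f a.
  move=> cf e e0; exact: (@cvg_within _ (nbhs z) _ _ _ (cf e e0)).
apply: (@ccvg_unique R R[i] z^' _ Psi); first exact: sub.
apply: ccvg_eq (sub _ _ c1).
have n1 : \forall y \near z^', y != z by exact: nbhs_dnbhs_neq.
have n2 : z^' (fun y => normc y < r).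
  exact: (@cvg_within _ (nbhs z) _ _ _ (near_normc_lt zr)).
move: n1 n2; apply: filterS2 => y yz yr.
have yz0 : y - z != 0 by rewrite subr_eq0.
apply: (mulfI yz0); rewrite -(herglotzB mu_circle t0 r1) ?ltW//.
by rewrite PsiE mulrC.
Qed.

Lemma cderiv_herglotz (S s : R) (z : R[i]) : 0 <= s -> normc z < 1 ->
  cderiv `[0, S] (fun x => M x z) s (- (2 * z * M s z * D s z z)).
Proof.
move=> s0 z1; rewrite -derive1_herglotz//.
apply: (cderiv_subset (A := `[0, +oo[%classic)); last first.
  by apply/cderivP/(burgers_pde (hydro_burgers hmu)) => //; exact/diskE.
by move=> x /=; rewrite !in_itv /= => /andP[-> _].
Qed.

(** At a fixed point, [M] is continuous in time by the Burgers equation, hence so is its divided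
    difference at two distinct fixed points. The Lipschitz bound in space transfers this to the
    moving point [y x]. *)
Lemma ccvg_herglotz_slope (S s r : R) (y : R -> R[i]) : 0 <= s <= S -> r < 1 ->
  (forall x, 0 <= x <= S -> normc (y x) <= r) ->
  ccvg (within `[0, S] s^') y (y s) ->
  ccvg (within `[0, S] s^') (fun x => D x (y x) (y s)) (D s (y s) (y s)).
Proof.
move=> sS r1 yr cy e e0; have /andP[s0 _] := sS.
pose r' := (1 + r) / 2; have rr' : r < r' by rewrite /r'; lra.
have r'1 : r' < 1 by rewrite /r'; lra.
pose C := 4 / (1 - r') ^+ 3.
have C0 : 0 < C by rewrite divr_gt0// exprn_gt0// subr_gt0.
(* The auxiliary point [w], at distance [d] from [y s], stays in the disk of radius [r']. Passing
   from [y x] to [w] and from [w] to [y s] costs [2 * C * d] and [C * d], together less than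
   [e / 2]. *)
pose d := Num.min (r' - r) (e / (8 * C)).
have d0 : 0 < d by rewrite lt_min subr_gt0 rr' divr_gt0// mulr_gt0.
have dr : d <= r' - r by rewrite ge_min lexx.
have de : d * (8 * C) <= e.
  have C8 : 0 < 8 * C by rewrite mulr_gt0.
  by rewrite -(ler_pdivlMr _ _ C8) ge_min lexx orbT.
pose w := y s + d%:C.
have ys := yr s sS; have ys' : normc (y s) <= r' by lra.
have nd : normc d%:C = d by rewrite normc_real gtr0_norm.
have wr : normc w <= r' by apply: le_trans (ler_normcD _ _) _; rewrite nd; lra.
have wy : w - y s = d%:C by rewrite /w addrC addKr.
have wy0 : w - y s != 0 by rewrite wy (inj_eq (@complexI _)) gt_eqF.
have slopeE x : 0 <= x -> D x w (y s) = (M x w - M x (y s)) / (w - y s).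
  by move=> x0; rewrite (herglotzB mu_circle x0 r'1)// mulrC mulKf.
have cM z : normc z <= r' -> ccvg (within `[0, S] s^') (fun x => M x z) (M s z).
  by move=> zr; apply: cderiv_cvg; apply: cderiv_herglotz => //; exact: le_lt_trans r'1.
have c1 : ccvg (within `[0, S] s^') (fun x => D x w (y s)) (D s w (y s)).
  rewrite slopeE//; apply: (@ccvg_eq _ _ _ _ (fun x => (M x w - M x (y s)) / (w - y s))).
    apply: (@filterE _ s^') => x /=; rewrite in_itv /= => /andP[x0 _].
    by rewrite slopeE.
  by apply: ccvgM; [apply: ccvgB; exact: cM|exact: ccvg_cst].
have e2 : 0 < e / 2 by rewrite divr_gt0.
have H1 := c1 _ e2; have H2 := cy _ d0.
apply: (@filterS2 _ s^' _ _ _ _ _ H1 H2) => x h1 h2 xS.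
have {}h1 := h1 xS; have {}h2 := h2 xS.
move: xS; rewrite /= in_itv /= => xS; have /andP[x0 _] := xS.
have yx : normc (y x) <= r' by have := yr x xS; lra.
have L1 := herglotz_slope_lip mu_circle x0 r'1 yx wr ys'.
have L2 := herglotz_slope_lip mu_circle s0 r'1 wr ys' ys'.
rewrite -/C in L1 L2; rewrite wy nd in L2.
have yw : normc (y x - w) <= 2 * d.
  have -> : y x - w = (y x - y s) - d%:C by rewrite -wy; ring.
  by apply: le_trans (ler_normcB _ _) _; rewrite nd; lra.
have L3 : C * normc (y x - w) <= C * (2 * d) by rewrite ler_pM2l.
have T1 := ler_normcD (D x (y x) (y s) - D x w (y s)) (D x w (y s) - D s (y s) (y s)).
have T2 := ler_normcD (D x w (y s) - D s w (y s)) (D s w (y s) - D s (y s) (y s)).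
rewrite addrA subrK in T1; rewrite addrA subrK in T2.
have dC0 : 0 < C * d by rewrite mulr_gt0.
rewrite mulrCA [d * C]mulrC in de; rewrite [C * (2 * d)]mulrCA in L3.
apply: le_lt_trans T1 _; apply: le_lt_trans (lerD L1 T2) _.
lra.
Qed.

(** Along [y x = u * cexp (2 * x * m)] one has [y' = 2 m y], so the Burgers equation gives
    [phi x = M x (y x) - m] the linear equation [phi' = - 2 y D phi]. As [phi 0 = 0], Gronwall's
    inequality applies. *)
Lemma burgers_characteristic (s : R) (u : R[i]) : 0 <= s -> normc u < 1 ->
  let m := (1 + u) / (1 - u) in
  normc (u * cexp (2 * s%:C * m)) < 1 -> M s (u * cexp (2 * s%:C * m)) = m.
Proof.
move=> s0 u1 m ys1; have m0 : 0 < complex.Re m by exact: Re_cayley_gt0.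
pose y (x : R) := u * cexp (2 * x%:C * m).
pose r := normc (y s).
have r0 : 0 <= r by exact: ger0_normc.
(* The real part of [m] is positive, so the modulus of [y] is largest at the final time. *)
have yr x : 0 <= x <= s -> normc (y x) <= r.
  move=> /andP[x0 xs]; rewrite /r /y (normcM u) (normcM u) !normc_cexp.
  rewrite ler_wpM2l ?ger0_normc// ler_expR.
  have E (a : R) (c : R[i]) : complex.Re (2 * a%:C * c) = 2 * a * complex.Re c.
    rewrite -(rmorph_nat (real_complex R)) -rmorphM.
    by case: c => p q /=; rewrite mul0r subr0.
  by rewrite !E ler_wpM2r ?(ltW m0)// ler_pM2l.
have hy x : 0 <= x <= s -> cderiv `[0, s] y x (2 * m * y x).
  move=> xs; apply: (cderiv_eq (f := fun x => u * cexp (2 * x%:C * m))).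
  - apply: cderivM; first exact: cderiv_cst.
    apply: cderiv_cexp; apply: cderivM; last exact: cderiv_cst.
    by apply: cderivM; [exact: cderiv_cst|exact: cderiv_id].
  - by move=> z _.
  - by rewrite /= in_itv.
  - by rewrite /y; ring.
have y1 x : 0 <= x <= s -> normc (y x) < 1.
  by move=> /yr /le_lt_trans; apply.
pose phi x := M x (y x) - m.
pose dphi x := - (2 * y x * D x (y x) (y x)) * phi x.
have hphi x : 0 <= x <= s -> cderiv `[0, s] phi x (dphi x).
  move=> xs; have /andP[x0 _] := xs.
  have cD := ccvg_herglotz_slope xs ys1 yr (cderiv_cvg (hy x xs)).
  have hM := cderiv_herglotz s x0 (y1 x xs).
  have -> : dphi x = 2 * m * y x * D x (y x) (y x) +
      - (2 * y x * M x (y x) * D x (y x) (y x)) by rewrite /dphi /phi; ring.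
  apply: ccvg_eq (ccvgD (ccvgM (hy x xs) cD) hM).
  apply: (@filterE _ x^') => z /=; rewrite in_itv /= => zs; have /andP[z0 _] := zs.
  have := herglotzB mu_circle z0 ys1 (yr z zs) (yr x xs) => E.
  (* The increment splits into a move in space at time [z], given by the divided difference, and a
     move in time at the fixed point [y x]. *)
  have -> : phi z - phi x = (M z (y z) - M z (y x)) + (M z (y x) - M x (y x)).
    by rewrite /phi; ring.
  by rewrite E; ring.
have phi0 : phi 0 = 0.
  have y0 : y 0 = u by rewrite /y mulr0 mul0r cexp0 mulr1.
  rewrite /phi y0 (burgers_init (hydro_burgers hmu)) ?subrr//.
  exact/diskE.
apply/eqP; rewrite -subr_eq0; apply/eqP; rewrite -[LHS]/(phi s).
apply: (@gronwall0 R phi dphi 0 s (2 * (4 / (1 - r) ^+ 2)) phi0 hphi); last by rewrite s0 lexx.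
move=> x /andP[x0 xs]; have xI : 0 <= x <= s by rewrite !ltW.
rewrite /dphi normcM normc_opp ler_wpM2r ?ger0_normc//.
rewrite normcM ler_pM ?ger0_normc//; last first.
  exact: (normc_herglotz_slope mu_circle (ltW x0) ys1 (yr x xI) (yr x xI)).
rewrite normcM -(rmorph_nat (real_complex R)) normc_real ger0_norm//.
by rewrite -[leRHS]mulr1 ler_wpM2l// ltW// y1.
Qed.

End Characteristics.

(** * Identification of the Loewner flow with the explicit flow *)

Theorem theorem1p5 (R : realType)
    (mu : R -> probability (borelC R) R) (g : R -> R[i] -> R[i])
    (W0 : R[i] -> R[i])
    (hmu : hydrodynamic_limit mu)
    (hg : loewner_flow (herglotz mu) g)
    (hW0 : principal_lambert W0)
    (t : R) (z : R[i]) (ht : 0 <= t) (hz : loewner_domain (herglotz mu) t z) :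
  (0 < t -> z != 0 -> g t z = lambert_formula W0 t z) /\
  (t = 0 \/ z = 0 ->
   lambert_formula W0 p.1 p.2
     @[p --> within [set p : R * R[i] | 0 < p.1 /\ p.2 != 0] (nbhs (t, z))]
   --> g t z).
Proof.
have /diskE z1 : disk z by case: hz.
have mu_circle := hydro_circle hmu.
have [g0 gP] := hg t z ht hz.
have gE : g t z = flow W0 t z.
  have [t0|t0|t0] := ltgtP t 0; first by move: ht; rewrite leNgt t0.
  2: by rewrite t0 flow0.
  pose psi s := g s z - flow W0 s z.
  pose dpsi s := g s z * herglotz mu s (g s z) - flow_m W0 s z * flow W0 s z.
  apply/eqP; rewrite -subr_eq0; apply/eqP; rewrite -[LHS]/(psi t).
  apply: (@gronwall_local R psi dpsi t); last by rewrite ht lexx.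
  - by rewrite /psi g0 flow0// subrr.
  - move=> s st; have [_ /cderivP hgs] := gP s st.
    by apply: cderivB => //; exact: cderiv_flow.
  (* When the two curves meet at time [s], both remain for a short time in a disk of radius [r < 1],
     where the Loewner field is Lipschitz. *)
  move=> s /andP[s0 st] ps.
  have sI : 0 <= s <= t by rewrite s0 ltW.
  have [/diskE gs1 /cderivP hgs] := gP s sI.
  pose r := (1 + normc (g s z)) / 2.
  have r1 : r < 1 by rewrite /r; lra.
  have e0 : 0 < r - normc (g s z) by rewrite /r; lra.
  have fs : flow W0 s z = g s z by apply/esym/eqP; rewrite -subr_eq0; apply/eqP.
  have hf := cderiv_flow hW0 t0 sI z1.
  have [d1 /= d10 dP1] := (nbhs_ballP _ _).1 (cderiv_cvg hgs e0).
  have [d2 /= d20 dP2] := (nbhs_ballP _ _).1 (cderiv_cvg hf e0).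
  pose K := 2 * ((1 + r) * (1 - r)^-1) + r * (4 / (1 - r) ^+ 2).
  exists K, (Num.min d1 d2); first by rewrite lt_min d10 d20.
  move=> x /andP[sx xd] xt.
  have x0 : 0 <= x by rewrite (le_trans s0)// ltW.
  have xI : x \in `[0, t] by rewrite in_itv /= x0 ltW.
  have xs : x != s by rewrite gt_eqF.
  have bl d : x < s + d -> ball s d x.
    by move=> H; rewrite /ball /= distrC gtr0_norm ?subr_gt0// ltrBlDl.
  move: xd; rewrite -ltrBlDl lt_min !ltrBlDl => /andP[xd1 xd2].
  have H1 := dP1 x (bl _ xd1) xs xI; have H2 := dP2 x (bl _ xd2) xs xI.
  rewrite fs in H2.
  have gr : normc (g x z) <= r.
    by have := ler_normcD (g x z - g s z) (g s z); rewrite subrK => ?; lra.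
  have fr : normc (flow W0 x z) <= r.
    by have := ler_normcD (flow W0 x z - g s z) (g s z); rewrite subrK => ?; lra.
  have m0 := Re_flow_m_gt0 hW0 x0 z1.
  have u1 : normc (flow_u W0 x z) < 1 by exact: normc_cayley_lt1.
  (* At time [x] the characteristic issued from [flow_u] is at [flow], so [M] there equals [flow_m]
     and [flow] obeys the Loewner equation. *)
  have := burgers_characteristic hmu x0 u1; rewrite /= cayleyK// -/(flow W0 x z).
  move=> /(_ (le_lt_trans fr r1)) Mf.
  (* With [f] the explicit flow, this is [g M(g) - f M(f) = (g - f) M(g) + f (M(g) - M(f))]; the two
     terms account for the two summands of [K]. *)
  have -> : dpsi x = psi x * herglotz mu x (g x z) +
      flow W0 x z * ((g x z - flow W0 x z) * herglotz_slope mu x (g x z) (flow W0 x z)).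
    by rewrite -(herglotzB mu_circle x0 r1 gr fr) Mf /dpsi /psi; ring.
  apply: le_trans (ler_normcD _ _) _.
  rewrite (normcM (psi x)) (normcM (flow W0 x z)) (normcM (g x z - _)).
  rewrite -/(psi x) /K mulrDl.
  apply: lerD; first by rewrite mulrC ler_wpM2r ?ger0_normc// normc_herglotz.
  rewrite mulrA mulrAC ler_wpM2r ?ger0_normc//.
  by rewrite ler_pM ?ger0_normc// normc_herglotz_slope.
split=> [t0 zn0|_]; first by rewrite flow_formula.
(* Near [(t, z)], the formula coincides with [flow] at positive times and nonzero points, and [flow]
   is continuous at [(t, z)] itself. *)
rewrite gE; apply/ccvgP.
pose F := within [set p : R * R[i] | 0 < p.1 /\ p.2 != 0] (nbhs (t, z)).
have FF : Filter F by exact: _.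
have near2 (P : set R[i]) : nbhs z P -> F (fun p => P p.2).
  move=> zP; apply: (@filterS _ (nbhs (t, z)) _ (fun p => P p.2)) => [p Pp _ //|].
  exact: (@cvg_snd _ _ (nbhs t) (nbhs z) _ _ zP).
apply: (@ccvg_eq _ _ F FF (fun p => flow W0 p.1 p.2)).
  apply: (@filterS _ (nbhs (t, z)) _ _ _ _ (near2 _ (near_normc_lt z1))) => p H pA.
  by have [p0 pz] := pA; rewrite flow_formula// H.
apply: ccvg_flow => //.
  apply: cvg_within_filter; exact: (@cvg_fst _ _ (nbhs t) (nbhs z) _).
move=> e e0; exact: (near2 (fun y => normc (y - z) < e) (@ccvg_nbhs_id R z _ e0)).
Qed.
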